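(* Let $A\in F^\times\setminus F^{\times 2}$, $E_3=F(\sqrt A)$, $\sigma$ the nontrivial automorphism of $E_3/F$, and let $D\in E_3^\times$ with $D\notin F^\times E_3^{\times 2}$ (so that $E_3(\sqrt D)/F$ is a quartic extension which is not biquadratic). Let $$Q(x,y,z,t)=2zt-\frac{D-\sigma(D)}{2\sqrt A}\,(y^2+Ax^2)-(D+\sigma(D))\,xy,$$ a quadratic form with coefficients in $F$, and for $\operatorname{Re}(s)>1/2$ put $I_s(A,D)=\int_{V^0}|Q(x,y,z,t)|^{2(s-1)}\,dx\,dy\,dz\,dt$. Then the value at $s=0$ of the meromorphic continuation of $I_s(A,D)$ is $0$.
   Context: $F$ is a nonarchimedean local field of odd residual characteristic, $R$ its ring of integers, $\varpi$ a uniformizer, $q$ the cardinality of the residue field, $|\varpi|=q^{-1}$. $dx$ is the Haar measure on $F$ with $\int_R dx=1$, and $dx\,dy\,dz\,dt$ the product measure on $F^4$. Let $\mathcal V=\{(x,y,z,t)\in R^4:\max(|x|,|y|,|z|,|t|)=1\}$. For a function $\Phi$ on $\mathcal V$ invariant under $v\mapsto\alpha v$ for all $\alpha\in R^\times$, $\int_{V^0}\Phi(v)\,dv$ denotes $(1-q^{-1})^{-1}\int_{\mathcal V}\Phi(v)\,dv$. The integral converges for $\operatorname{Re}(s)>1/2$; ''value at $s=0$'' refers to its meromorphic continuation in $s$. *)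

(* Defs.v *)
From HB Require Import structures.
From mathcomp Require Import all_boot all_order all_algebra all_field.
From mathcomp Require Import complex.
From mathcomp Require Import all_classical all_reals all_analysis.

Set Implicit Arguments.
Unset Strict Implicit.
Unset Printing Implicit Defensive.

Import Order.TTheory GRing.Theory Num.Theory.
Import numFieldNormedType.Exports.

Local Open Scope classical_set_scope.
Local Open Scope ring_scope.

(** * Nonarchimedean local fields *)

HB.mixin Record isCompleteUltrametricField (R : realType) F
    & GRing.Field F & Uniform F := {
  labs : F -> R; (* the absolute value *)
  labs_ge0 : forall x, 0 <= labs x;
  labs_eq0 : forall x, (labs x == 0) = (x == 0);
  labsM : forall x y, labs (x * y) = labs x * labs y;
  labs_ultra : forall x y, labs (x + y) <= Num.max (labs x) (labs y);
  labs_complete : forall G : set_system F,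
    ProperFilter G -> cauchy G -> exists l : F, G --> l;
  entourage_labs : entourage =
    entourage_ (fun (x : F) (e : R) => [set y | labs (x - y) < e])
}.

#[short(type="completeUltrametricFieldType")]
HB.structure Definition CompleteUltrametricField (R : realType) :=
  { F of GRing.Field F & Uniform F
       & isCompleteUltrametricField R F }.

Section IntegerRing.
Variables (R : realType) (F : completeUltrametricFieldType R).

Lemma labs1 : labs (1 : F) = 1 :> R.
Proof.
have n0 : labs (1 : F) != 0 :> R by rewrite labs_eq0 oner_neq0.
by apply: (mulfI n0); rewrite -labsM !mulr1.
Qed.

Lemma labsN (x : F) : labs (- x) = labs x :> R.
Proof.
have h : labs (-1 : F) = 1 :> R.
  apply/eqP; rewrite -(@pexpr_eq1 _ _ 2) ?labs_ge0//.
  by rewrite expr2 -labsM mulrNN mulr1 labs1.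
by rewrite -mulN1r labsM h mul1r.
Qed.

Definition integral_pred : {pred F} := [pred x | labs x <= 1 :> R].

Fact integral_subring : subring_closed integral_pred.
Proof.
split=> [|x y|x y]; rewrite !inE ?labs1// => hx hy.
  by rewrite (le_trans (labs_ultra _ _))// ge_max hx labsN hy.
by rewrite labsM mulr_ile1// labs_ge0.
Qed.

HB.instance Definition _ :=
  GRing.isSubringClosed.Build F integral_pred integral_subring.

Definition integer_ring := {x : F | x \in integral_pred}.
HB.instance Definition _ := SubChoice.on integer_ring.
HB.instance Definition _ :=
  [SubChoice_isSubComNzRing of integer_ring by <:].

Definition maximal_ideal : {pred integer_ring} :=
  [pred x | labs (val x) < 1 :> R].

Fact maximal_idealr_closed : idealr_closed maximal_ideal.
Proof.
split=> [||a x y]; rewrite !inE /= ?labs1 ?ltxx//.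
  by rewrite (_ : labs _ = 0) ?ltr01//; apply/eqP; rewrite labs_eq0.
move=> hx hy; rewrite (le_lt_trans (labs_ultra _ _))// gt_max hy andbT.
by rewrite labsM (le_lt_trans _ hx)// ler_piMl ?labs_ge0//; exact: (valP a).
Qed.

HB.instance Definition _ :=
  isIdealr.Build integer_ring maximal_ideal maximal_idealr_closed.

Definition residue_field :=
  ring_quotient.Quotient.quot (maximal_ideal : idealr integer_ring).
HB.instance Definition _ := GRing.ComNzRing.on residue_field.

End IntegerRing.

(* The absolute value is normalized by [|uniformizer| = 1 / q], where [q] is
   the cardinality of the residue field; [uniformizerP] says that the
   uniformizer generates the maximal ideal. *)
HB.mixin Record isNonarchLocalField (R : realType) F
    & CompleteUltrametricField R F := {
  residue_card : nat;
  residue_cardP : ([set: residue_field F] #= `I_residue_card)%card;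
  uniformizer : F;
  labs_uniformizer : labs uniformizer = residue_card%:R^-1 :> R;
  uniformizerP : forall x : F,
    labs x < 1 :> R -> labs x <= labs uniformizer :> R
}.

#[short(type="nonarchLocalFieldType")]
HB.structure Definition NonarchLocalField (R : realType) :=
  { F of CompleteUltrametricField R F & isNonarchLocalField R F }.

Definition odd_residual_char (R : realType) (F : nonarchLocalFieldType R) :=
  forall p : nat, p \in [pchar (residue_field F)] -> odd p.

(** * Haar measure *)

Section Haar.
Variables (R : realType) (F : nonarchLocalFieldType R).

(* [g_sigma_algebraType] wants a pointed type. *)
Definition pointed_field : Type := F.
HB.instance Definition _ := Choice.on pointed_field.
HB.instance Definition _ := isPointed.Build pointed_field (0 : F).

Definition borel := g_sigma_algebraType (open : set (set pointed_field)).
HB.instance Definition _ := Measurable.on borel.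

(* Translation-invariant Borel measure giving mass 1 to the compact open ring
   of integers; finiteness on compact sets and regularity follow. *)
Definition normalized_haar (mu : set borel -> \bar R) :=
  (forall (a : F) (B : set borel), measurable B ->
     mu [set a + (x : F) | x in B] = mu B) /\
  mu [set x | labs (x : F) <= 1 :> R] = 1%E.

End Haar.

(** * The quadratic form *)

Section QuadraticForm.
Variables (F : fieldType) (E : fieldExtType F).

(* The element of [F] whose image in [E] is [u], when there is one. *)
Definition descend (u : E) : F := xget 0 [set c : F | c%:A = u].

Variables (A : F) (rootA : E) (sigma : 'AEnd(E)) (D : E).

Definition quad_form (x y z t : F) : F :=
  2 * z * t
  - descend ((D - sigma D) / (2 * rootA)) * (y ^+ 2 + A * x ^+ 2)
  - descend (D + sigma D) * x * y.

Hypothesis two_neq0 : (2 : F) != 0.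
Hypothesis rootA_sqr : rootA ^+ 2 = A%:A.
Hypothesis rootA_gen : <<1; rootA>>%VS = {:E}%VS.
Hypothesis sigma_neq1 : sigma != \1%AF.

Lemma rootA_decomp (u : E) : exists a b : F, u = a%:A + b *: rootA.
Proof.
have : u \in <<1; rootA>>%VS by rewrite rootA_gen memvf.
move=> /Fadjoin_polyP[p /polyOver1P[r ->] ->].
have h (a b : F) : ((a%:A : E) * rootA + b%:A) = b%:A + a *: rootA.
  by rewrite mulr_algl addrC.
elim/poly_ind: r => [|r c [a [b IH]]].
  by exists 0, 0; rewrite rmorph0 horner0 !scale0r addr0.
exists (b * A + c), a.
rewrite rmorphD rmorphM /= map_polyX map_polyC hornerMXaddC IH.
rewrite mulrDl mulr_algl -scalerAl -expr2 rootA_sqr scalerA scalerDl.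
by rewrite -addrA addrC.
Qed.

Lemma sigma_rootA : sigma rootA = - rootA.
Proof.
have : (sigma rootA - rootA) * (sigma rootA + rootA) == 0.
  by rewrite -subr_sqr -rmorphXn /= rootA_sqr linearZ /= rmorph1 subrr.
rewrite mulf_eq0 subr_eq0 addr_eq0 => /orP[/eqP h|/eqP//].
case/negP: sigma_neq1; apply/eqP/val_inj/lfunP => u /=.
have [a [b ->]] := rootA_decomp u.
by rewrite id_lfunE linearD !linearZ /= rmorph1 h.
Qed.

Lemma descendK (u : E) : sigma u = u -> (descend u)%:A = u.
Proof.
have [a [b ->]] := rootA_decomp u.
rewrite linearD !linearZ /= rmorph1 sigma_rootA => /addrI/eqP.
rewrite scalerN eq_sym -addr_eq0 -mulr2n -scaler_nat scaler_eq0.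
rewrite (negPf two_neq0) /= => /eqP ->; rewrite addr0 /descend.
by case: xgetP => [c _ //|/(_ a) /=].
Qed.

Lemma sigmaK (u : E) : sigma (sigma u) = u.
Proof.
have [a [b ->]] := rootA_decomp u.
rewrite !(linearD, linearZ) /= !rmorph1 !sigma_rootA linearN /= sigma_rootA.
by rewrite opprK.
Qed.

(* The coefficients of [quad_form] do descend to [F]. *)
Lemma quad_formE (x y z t : F) :
  (quad_form x y z t)%:A =
  2 * z%:A * t%:A
  - (D - sigma D) / (2 * rootA) * (y%:A ^+ 2 + A%:A * x%:A ^+ 2)
  - (D + sigma D) * x%:A * y%:A.
Proof.
have inj2 : (2%:A : E) = 2 by rewrite scaler_nat.
have ab (a b : F) : ((a * b)%:A : E) = a%:A * b%:A by rewrite -in_algE rmorphM.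
rewrite /quad_form !scalerBl !ab scalerDl !ab !descendK ?inj2//.
- by rewrite linearD /= sigmaK addrC.
- rewrite rmorphM /= linearB /= sigmaK fmorphV rmorphM /= sigma_rootA.
  by rewrite rmorph_nat mulrN invrN mulrN -mulNr opprB.
Qed.
End QuadraticForm.

(** * The integral *)

Local Open Scope complex_scope.

(* [r ^ z] for [r > 0], i.e. exp (z * ln r); the value at [r = 0] is a
   convention, used below only on a null set. *)
Definition cpow (R : realType) (r : R) (z : R[i]) : R[i] :=
  if r == 0 then 0
  else (expR (complex.Re z * ln r))%:C *
       (cos (complex.Im z * ln r) +i* sin (complex.Im z * ln r)).

Section ComplexIntegral.
Variables (R : realType) (d : measure_display) (T : measurableType d).
Variables (mu : {measure set T -> \bar R}) (B : set T) (f : T -> R[i]).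

Definition cintegrable :=
  mu.-integrable B (EFin \o (fun x => complex.Re (f x))) /\
  mu.-integrable B (EFin \o (fun x => complex.Im (f x))).

Definition cintegral : R[i] :=
  Rintegral mu B (fun x => complex.Re (f x)) +i*
  Rintegral mu B (fun x => complex.Im (f x)).

End ComplexIntegral.

Section PrimitiveVectors.
Variables (R : realType) (F : nonarchLocalFieldType R).
Variable mu : {sigma_finite_measure set (borel F) -> \bar R}.

(* Condition max (|x|, |y|, |z|, |t|) = 1; it forces all coordinates to be
   integral. *)
Definition primitive_vectors : set (borel F * borel F * borel F * borel F) :=
  [set v | let: (x, y, z, t) := v in
     Num.max (Num.max (Num.max (labs (x : F)) (labs (y : F))) (labs (z : F)))
       (labs (t : F)) = 1 :> R].

Definition haar4 :
    {measure set (borel F * borel F * borel F * borel F) -> \bar R} :=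
  (mu \x mu \x mu \x mu)%E.

Definition V0_integrable (Phi : F -> F -> F -> F -> R[i]) :=
  cintegrable haar4 primitive_vectors
    (fun v => let: (x, y, z, t) := v in Phi x y z t).

Definition V0_integral (Phi : F -> F -> F -> F -> R[i]) : R[i] :=
  ((1 - (@residue_card R F)%:R^-1)^-1)%:C *
  cintegral haar4 primitive_vectors
    (fun v => let: (x, y, z, t) := v in Phi x y z t).

End PrimitiveVectors.

Section Zeta.
Variables (R : realType) (F : nonarchLocalFieldType R).
Variable mu : {sigma_finite_measure set (borel F) -> \bar R}.
Variables (E : fieldExtType F) (A : F) (rootA : E) (sigma : 'AEnd(E)) (D : E).

Definition zeta_integrand (s : R[i]) (x y z t : F) : R[i] :=
  cpow (labs (quad_form A rootA sigma D x y z t)) (2 * (s - 1)).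

Definition zeta_converges (s : R[i]) := V0_integrable mu (zeta_integrand s).

Definition zeta (s : R[i]) : R[i] := V0_integral mu (zeta_integrand s).

End Zeta.

(** * Meromorphic continuation *)

Section Meromorphic.
Variable R : realType.
Local Notation C := (R[i])^o.

Definition holomorphic_at (f : C -> C) (z : C) :=
  \forall w \near z, derivable f w 1.

(* Near [z], away from [z] itself, [f] is holomorphic up to a power of
   [w - z]; the values of [f] at its poles are unconstrained. *)
Definition meromorphic_at (f : C -> C) (z : C) :=
  exists (n : nat) (g : C -> C), holomorphic_at g z /\
    \forall w \near z^', (w - z) ^+ n * f w = g w.

(* [f], given on [U], has a meromorphic continuation to the complex plane
   which is holomorphic at [z0] with value [v] there; for [U] open nonempty
   the identity theorem makes [v] unique. *)
Definition continued_value (U : set C) (f : C -> C) (z0 v : C) :=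
  exists g : C -> C,
    [/\ forall z, meromorphic_at g z,
        forall z, U z -> g z = f z,
        holomorphic_at g z0 & g z0 = v].

End Meromorphic.

(* Main.v *)
Require Import Defs.
From HB Require Import structures.
From mathcomp Require Import all_boot all_order all_algebra all_field.
From mathcomp Require Import complex.
From mathcomp Require Import all_classical all_reals all_analysis.
From mathcomp Require Import ring lra generic_quotient measurable_realfun.

Set Implicit Arguments.
Unset Strict Implicit.
Unset Printing Implicit Defensive.

Import Order.TTheory GRing.Theory Num.Theory.
Import numFieldNormedType.Exports.

Local Open Scope classical_set_scope.
Local Open Scope ring_scope.

(** The form is [Q = 2 z t - p (x, y)], where [p (x, y)] is the coefficient of
    [sqrt A] in [D (y + x sqrt A) ^ 2]; the hypotheses on [A] and [D] say exactly
    that [p] is anisotropic, so that by compactness [|p|] is bounded below on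
    primitive pairs.

    Let [N_k] be the volume of [{v in R ^ 4, |Q v| <= q ^ -k}] and [T_k] that of
    [{u in R ^ 2, |p u| <= q ^ -k}].  Slicing along [|z| = q ^ -i] gives, for
    [k >= 0], [N_k = q ^ -k ((1 - 1/q) (T_0 + ... + T_k) + T_k / q)], and
    anisotropy gives [T_(k+2) = q ^ -2 T_k] for large [k]; hence
    [N_(k+2) = q ^ -3 N_k + (q - 1) q ^ -2 N_(k+1)] for large [k].

    The primitive vectors with [|Q v| <= q ^ -k] have volume
    [N_k - q ^ -4 N_(k-2)], which by this recurrence is eventually proportional to
    [q ^ -k].  So the integral is a finite sum plus a geometric series in
    [w = q ^ (-2 (s - 1))], a rational function of [w] with a simple pole at
    [w = q].  At [s = 0], i.e. [w = q ^ 2], the finite sum telescopes and the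
    recurrence makes the total vanish. *)

(** * The absolute value *)

(** The vanishing has a structural reason. Put [d_j = N_j - N_(j+1)] and let [G (w)] be the
    generating series of the [d_j]. Passing to primitive vectors replaces [d_j] by
    [d_j - q ^ -4 d_(j-2)], so it multiplies [G] by [1 - q ^ -4 w ^ 2], whose zeros are [w = q ^ 2]
    and [w = - q ^ 2]. The recurrence for [N] has characteristic roots [q ^ -1] and [- q ^ -2], so
    [G] can have poles only at [w = q] and [w = - q ^ 2]. The factor cancels the second pole, which
    is why a single geometric tail of ratio [q ^ -1] survives, and it vanishes at [w = q ^ 2], where
    [G] is regular. The coefficients of [p] need not be integral, so [|Q|] may exceed [1] on
    integral vectors. All levels are therefore counted from a bound [q ^ C] on [|Q|]; this only
    shifts the index and multiplies the series by a power of [w]. Haar measure is given by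
    translation invariance alone. Its behaviour under the uniformizer is derived from the masses of
    balls and then carried through the products. *)

Section LocalField.
Context (R : realType) (F : nonarchLocalFieldType R).
Implicit Types x y : F.

Local Notation q := (@residue_card R F).
Local Notation qi := ((@residue_card R F)%:R^-1 : R).
Local Notation pi := (@uniformizer R F).

Lemma labs0 : labs (0 : F) = 0 :> R.
Proof. by apply/eqP; rewrite labs_eq0. Qed.

Lemma labs_gt0 x : (0 < labs x :> R) = (x != 0).
Proof. by rewrite lt_neqAle labs_ge0 andbT eq_sym labs_eq0. Qed.

Lemma labsV x : labs x^-1 = (labs x)^-1 :> R.
Proof.
have [->|x0] := eqVneq x 0; first by rewrite invr0 labs0 invr0.
by apply: (mulfI (x := labs x)); rewrite ?labs_eq0// -labsM !divff ?labs1 ?labs_eq0.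
Qed.

Lemma labsX x n : labs (x ^+ n) = labs x ^+ n :> R.
Proof. by elim: n => [|n IH]; rewrite ?expr0 ?labs1// !exprS labsM IH. Qed.

Lemma labsB x y : labs (x - y) = labs (y - x) :> R.
Proof. by rewrite -labsN opprB. Qed.

Lemma labsD_le x y (r : R) : labs x <= r -> labs y <= r -> labs (x + y) <= r.
Proof. by move=> hx hy; rewrite (le_trans (labs_ultra _ _))// ge_max hx. Qed.

Lemma labsB_le x y (r : R) : labs x <= r -> labs y <= r -> labs (x - y) <= r.
Proof. by move=> hx hy; apply: labsD_le; rewrite ?labsN. Qed.

Lemma labs_chain y x z (r : R) :
  labs (x - y) <= r -> labs (y - z) <= r -> labs (x - z) <= r.
Proof. by move=> xy yz; rewrite -(subrK y x) -addrA labsD_le. Qed.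

Lemma labs_isosceles x y : labs y < labs x :> R -> labs (x + y) = labs x :> R.
Proof.
move=> yx; apply/eqP; rewrite eq_le; apply/andP; split.
  by apply: labsD_le => //; exact: ltW.
have := labs_ultra (x + y) (- y); rewrite addrK labsN le_max => /orP[//|h].
by move: (lt_le_trans yx h); rewrite ltxx.
Qed.

Lemma residue_card_gt1 : (1 < q)%N.
Proof.
have /card_set_bijP[f [fS fI _]] := @residue_cardP R F.
have := fS 0 Logic.I; have := fS 1 Logic.I; rewrite /= => f1 f0.
rewrite ltnNge; apply/negP => q1.
have : f 1 = f 0.
  move: (leq_trans f1 q1) (leq_trans f0 q1).
  by rewrite !ltnS !leqn0 => /eqP -> /eqP ->.
by move=> /fI; rewrite !inE => /(_ Logic.I Logic.I)/eqP; rewrite oner_eq0.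
Qed.

Lemma residue_card_inv_gt0 : 0 < qi.
Proof. by rewrite invr_gt0 ltr0n (ltn_trans _ residue_card_gt1). Qed.

Lemma residue_card_inv_lt1 : qi < 1.
Proof. by rewrite invf_lt1 ?ltr0n ?ltr1n ?residue_card_gt1// (ltn_trans _ residue_card_gt1). Qed.

Local Notation qi0 := residue_card_inv_gt0.
Local Notation qi1 := residue_card_inv_lt1.

Lemma uniformizer_neq0 : pi != 0.
Proof. by rewrite -labs_gt0 labs_uniformizer qi0. Qed.

Lemma labs_uniformizerX n : labs (pi ^+ n) = qi ^+ n :> R.
Proof. by rewrite labsX labs_uniformizer. Qed.

Lemma labs_lt1 x : (labs x < 1 :> R) = (labs x <= qi).
Proof.
apply/idP/idP => [/uniformizerP|/le_lt_trans]; first by rewrite labs_uniformizer.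
by apply; exact: qi1.
Qed.

Lemma residue_expr_small (e : R) : 0 < e -> exists n, qi ^+ n < e.
Proof.
move=> e0; have /cvgrPdist_lt/(_ _ e0) : qi ^+ n @[n --> \oo] --> 0.
  by apply: cvg_expr; rewrite ger0_norm ?qi1// ltW ?qi0.
move=> [n _ /(_ n (leqnn n))] /=; rewrite sub0r normrN normrX.
by rewrite ger0_norm ?(ltW qi0)// => h; exists n.
Qed.

(** Congruence modulo the maximal ideal is phrased as distance at most [1 / q], so that later
    arguments use [labs] only and never the quotient ring. *)
Lemma residue_reps : exists r : nat -> F,
  [/\ forall i, labs (r i) <= 1 :> R,
      forall x, labs x <= 1 :> R -> exists2 i, (i < q)%N & labs (x - r i) <= qi
    & forall i j, (i < q)%N -> (j < q)%N -> labs (r i - r j) <= qi -> i = j].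
Proof.
have /card_set_bijP[f [fS fI fT]] := @residue_cardP R F.
have [g gP] : exists g : nat -> integer_ring F,
    forall i, (i < q)%N -> f (\pi_(residue_field F) (g i))%qT = i.
  have : forall i, exists u : integer_ring F, (i < q)%N ->
      f (\pi_(residue_field F) u)%qT = i.
    move=> i; case: (ltnP i q) => [iq|_]; last by exists 0.
    have [u _ fu] := fT i iq; exists (repr u) => _.
    by rewrite reprK.
  by move=> /choice[g gP]; exists g.
exists (fun i => val (g i)); split => [i|x x1|i j iq jq].
- exact: (valP (g i)).
- pose u : integer_ring F := Sub x x1.
  exists (f (\pi_(residue_field F) u)%qT); first exact: fS.
  rewrite -labs_lt1; set i := f _.
  have : (\pi_(residue_field F) u = \pi_(residue_field F) (g i))%qT.
    by apply: fI; rewrite ?inE// gP//; exact: fS.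
  by move/eqP; rewrite -Quotient.idealrBE inE.
- rewrite -labs_lt1 => h.
  have : (\pi_(residue_field F) (g i) = \pi_(residue_field F) (g j))%qT.
    by apply/eqP; rewrite -Quotient.idealrBE inE.
  by move/(congr1 f); rewrite !gP.
Qed.

(** Digit expansion: subtract the representative of the residue class, divide by the uniformizer,
    and approximate the quotient with one digit less. *)
Lemma integer_totally_bounded n : exists s : seq F,
  forall x, labs x <= 1 :> R -> exists2 a, a \in s & labs (x - a) <= qi ^+ n.
Proof.
have [r [r1 rT _]] := residue_reps.
elim: n => [|n [s IH]].
  by exists [:: 0] => x x1; exists 0; rewrite ?mem_head// subr0 expr0.
exists [seq r i + pi * a | i <- iota 0 q, a <- s] => x x1.
have [i iq xi] := rT x x1.
have [a aS xa] : exists2 a, a \in s & labs ((x - r i) / pi - a) <= qi ^+ n.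
  apply: IH; rewrite labsM labsV labs_uniformizer.
  by rewrite ler_pdivrMr ?qi0// mul1r.
exists (r i + pi * a); first by apply: allpairs_f => //; rewrite mem_iota.
have -> : x - (r i + pi * a) = pi * ((x - r i) / pi - a).
  by rewrite mulrBr mulrCA divff ?uniformizer_neq0// mulr1 opprD addrA.
by rewrite labsM labs_uniformizer exprS ler_pM2l// qi0.
Qed.

(** The centres are [pi ^- m * a] with [a] in one of the finite nets of the integers. Countability
    is what later allows open sets to be written as countable unions of balls. *)
Lemma local_field_dense : exists e : nat -> F,
  forall x n, exists i, labs (x - e i) <= qi ^+ n.
Proof.
have /choice[s sP] := integer_totally_bounded.
pose c (u : nat * nat * nat) := pi ^- u.1.1 * nth 0 (s u.1.2) u.2.
exists (fun k => if unpickle k is Some u then c u else 0) => x n.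
have [m xm] : exists m, labs (x * pi ^+ m) <= 1 :> R.
  have [->|x0] := eqVneq x 0; first by exists 0; rewrite mul0r labs0.
  have [m mx] : exists m, qi ^+ m < (labs x)^-1.
    by apply: residue_expr_small; rewrite invr_gt0 labs_gt0.
  exists m; rewrite labsM labs_uniformizerX mulrC -ler_pdivlMr ?labs_gt0//.
  by rewrite div1r ltW.
(* Dividing by [pi ^+ m] loses [m] digits, so the net must be [m] digits finer than the target. *)
have [a am xa] := sP (m + n)%N _ xm.
exists (pickle (m, (m + n)%N, index a (s (m + n)%N))); rewrite pickleK /c /=.
rewrite nth_index//.
have -> : x - pi ^- m * a = pi ^- m * (x * pi ^+ m - a).
  by rewrite mulrBr mulrCA mulVf ?mulr1// expf_neq0// uniformizer_neq0.
rewrite labsM labsV labs_uniformizerX mulrC ler_pdivrMr ?exprn_gt0 ?qi0//.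
by rewrite -exprD addnC.
Qed.

Lemma nbhs_labsP x (A : set F) :
  nbhs x A <-> exists2 e : R, 0 < e & forall y, labs (x - y) < e -> A y.
Proof.
rewrite -nbhs_entourageE /nbhs_ entourage_labs /filter_from/=; split.
- move=> [B [e /= e0 eB] BA]; exists e => // y xy; apply: BA.
  by rewrite /xsection/= inE; exact: eB.
- move=> [e e0 eA]; exists [set xy | labs (xy.1 - xy.2) < e].
    by exists e.
  by move=> y; rewrite /xsection/= inE => /eA.
Qed.

Lemma open_labsP (A : set F) : open A <->
  forall x, A x -> exists n, forall y, labs (x - y) <= qi ^+ n -> A y.
Proof.
rewrite openE; split => [h x /h|h x /h[n nA]].
- rewrite /interior => /nbhs_labsP[e e0 eA].
  have [n ne] := residue_expr_small e0; exists n => y xy.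
  by apply: eA; exact: le_lt_trans ne.
- rewrite /interior; apply/nbhs_labsP; exists (qi ^+ n); rewrite ?exprn_gt0 ?qi0//.
  by move=> y /ltW/nA.
Qed.

Lemma open_closed_ball (c : F) (r : R) : 0 < r ->
  open [set x : F | labs (x - c) <= r].
Proof.
move=> r0; apply/open_labsP => x /= xc; have [n nr] := residue_expr_small r0.
exists n => y xy; rewrite -(subrK x y) -addrA; apply: labsD_le => //.
by rewrite labsB (le_trans xy)// ltW.
Qed.

(* An ultrafilter containing the integers is Cauchy because they are totally
   bounded. *)
Lemma integer_ultra_cvg (G : set_system F) : UltraFilter G ->
  G [set x | labs x <= 1 :> R] -> exists l : F, G --> l.
Proof.
move=> GU G1; apply: (labs_complete (R := R)).
suff h n : exists a, G [set x | labs (x - a) <= qi ^+ n].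
  rewrite /cauchy entourage_labs => B [e /= e0 eB].
  have [n ne] := residue_expr_small e0.
  have [a Ga] := h n.
  exists ([set x | labs (x - a) <= qi ^+ n], [set x | labs (x - a) <= qi ^+ n]) => //.
  move=> [x y] [/= xa ya]; apply: eB => /=; apply: le_lt_trans ne.
  have -> : x - y = (x - a) - (y - a) by rewrite opprB addrA subrK.
  exact: labsB_le.
have [s sP] := integer_totally_bounded n.
apply: contrapT => /forallNP hN.
have : G [set x | forall a, a \in s -> ~ labs (x - a) <= qi ^+ n].
  elim: s {sP} => [|a s IH]; first by apply: filterS filterT => x _ a.
  have Ga : G (~` [set x | labs (x - a) <= qi ^+ n]).
    by have [/hN//|] := in_ultra_setVsetC [set x | labs (x - a) <= qi ^+ n] GU.
  apply: filterS (filterI Ga IH) => x [xa xs] b.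
  by rewrite inE => /orP[/eqP ->|/xs].
move=> h; have [x [xh x1]] := filter_ex (filterI h G1).
by have [a /xh] := sP x x1.
Qed.

End LocalField.

(** * Products and Haar measure *)

Section ProductMeasure.
Context (R : realType) d1 d2 (T1 : measurableType d1) (T2 : measurableType d2).
Variable m1 : {measure set T1 -> \bar R}.
Variable m2 : {sigma_finite_measure set T2 -> \bar R}.
Local Open Scope ereal_scope.

(** A form of Tonelli for sets that are not rectangles but whose sections over [A] have equal mass,
    such as balls of fixed radius with a moving centre. *)
Lemma product_measure_const_section (S : set (T1 * T2)) (A : set T1) (c : \bar R) :
  measurable S -> measurable A -> 0 <= c ->
  (forall x, A x -> m2 (xsection S x) = c) ->
  (forall x y, S (x, y) -> A x) ->
  (m1 \x m2) S = m1 A * c.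
Proof.
move=> mS mA c0 Sc SA; rewrite /product_measure1 /=.
rewrite (eq_integral (fun x => (\1_A x)%:E * c)); last first.
  move=> x _; rewrite indicE; have [xA|xA] /= := boolP (x \in A).
    by rewrite mul1e Sc// -in_setE.
  rewrite mul0e (_ : xsection S x = set0) ?measure0// -subset0 => y.
  by rewrite /xsection/= inE => /SA; rewrite -in_setE (negbTE xA).
rewrite ge0_integralZr//.
- by rewrite integral_indic// setIT.
- by apply/measurable_EFinP; exact: measurable_indic.
Qed.

(** The factor [a2] comes out of each section, and [a1] from identifying the pushforward of [m1]
    with a scaled [m1]. The conclusion has the shape of the hypotheses, so the lemma iterates to
    four variables. *)
Lemma product_measure_scale (g1 : T1 -> T1) (g2 : T2 -> T2) (a1 a2 : {nonneg R})
    (S : set (T1 * T2)) :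
  measurable_fun setT g1 ->
  (forall B, measurable B -> m1 (g1 @^-1` B) = a1%:num%:E * m1 B) ->
  (forall B, measurable B -> m2 (g2 @^-1` B) = a2%:num%:E * m2 B) ->
  measurable S ->
  (m1 \x m2) ((fun u => (g1 u.1, g2 u.2)) @^-1` S) =
    (a1%:num * a2%:num)%:E * (m1 \x m2) S.
Proof.
move=> mg1 h1 h2 mS; rewrite /product_measure1 /=.
pose h := m2 \o xsection S.
have mh := @measurable_fun_xsection _ _ _ _ _ m2 _ mS; rewrite -/h in mh.
transitivity (\int[m1]_x (a2%:num%:E * (h \o g1) x)).
  apply: eq_integral => x _ /=; rewrite -h2; last exact: measurable_xsection.
  by congr (m2 _); apply/seteqP; split => y; rewrite /xsection/= !inE.
rewrite ge0_integralZl//; last exact: measurableT_comp.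
pose phi : {mfun T1 >-> T1} := HB.pack g1 (isMeasurableFun.Build _ _ _ _ g1 mg1).
transitivity (a2%:num%:E * \int[pushforward m1 phi]_x h x).
  by rewrite (ge0_integral_pushforward mg1)// => x _; exact: measure_ge0.
rewrite (@eq_measure_integral _ _ _ _ (mscale a1 m1) (pushforward m1 phi)); last first.
  by move=> A mA _; rewrite /pushforward /= /mscale/= -h1.
rewrite ge0_integral_mscale//.
by rewrite muleA -EFinM mulrC.
Qed.

End ProductMeasure.

Lemma pushforward_measure (R : realType) d1 d2 (T1 : measurableType d1)
    (T2 : measurableType d2) (m : {measure set T1 -> \bar R}) (f : T1 -> T2) :
  measurable_fun setT f ->
  exists m' : {measure set T2 -> \bar R}, forall A, m' A = m (f @^-1` A).
Proof.
move=> mf.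
by unshelve refine (ex_intro _ (pushforward m f : {measure set T2 -> \bar R}) _).
Qed.

Section Haar.
Context (R : realType) (F : nonarchLocalFieldType R).

Local Notation q := (@residue_card R F).
Local Notation qi := ((@residue_card R F)%:R^-1 : R).
Local Notation pi := (@uniformizer R F).
Local Notation qi0 := (@residue_card_inv_gt0 R F).
Local Notation qi1 := (@residue_card_inv_lt1 R F).

Definition closed_ball_at (c : F) (r : R) : set (borel F) :=
  [set x | labs ((x : F) - c) <= r].
Local Notation cball := closed_ball_at.

Lemma closed_ball_at_center (c x : F) (r : R) : labs (x - c) <= r ->
  cball c r = cball x r.
Proof.
move=> xc; apply/seteqP; split => y; rewrite /cball/= => h.
  by apply: (labs_chain h); rewrite labsB.
exact: (labs_chain h).
Qed.

Lemma measurable_open (O : set F) : open O -> measurable (O : set (borel F)).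
Proof. by move=> oO; apply: sub_sigma_algebra. Qed.

Lemma measurable_closed_ball_at c r : 0 < r -> measurable (cball c r).
Proof. by move=> r0; apply: measurable_open; exact: open_closed_ball. Qed.

(* Ultrametric balls are nested or disjoint, so they form a pi-system. *)
Definition ball_system : set (set (borel F)) :=
  [set B | B = set0 \/ exists c n, B = cball c (qi ^+ n)].

Lemma ball_system_setI : setI_closed ball_system.
Proof.
have H c n c' n' : (n <= n')%N ->
    ball_system (cball c (qi ^+ n) `&` cball c' (qi ^+ n')).
  move=> nn; have [[x [xc xc']]|] := pselect (exists x, cball c (qi ^+ n) x /\ cball c' (qi ^+ n') x).
    right; exists x, n'; rewrite (closed_ball_at_center xc) (closed_ball_at_center xc').
    apply: setIidr => y; rewrite /cball /= => /le_trans; apply.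
    by apply: ler_wiXn2l; rewrite ?(ltW qi0) ?(ltW qi1).
  move=> h; left; rewrite -subset0 => x [? ?]; apply: h; by exists x.
move=> A B [->|[c [n ->]]]; first by rewrite set0I; left.
move=> [->|[c' [n' ->]]]; first by rewrite setI0; left.
by case: (leqP n n') => [|/ltnW] nn; [|rewrite setIC]; exact: H.
Qed.

(** An open set is the union of the balls that it contains and whose centre lies in the countable
    dense family; conversely each ball is open. *)
Lemma ball_system_generates : @measurable _ (borel F) = <<s ball_system >>.
Proof.
have [e eP] := @local_field_dense R F.
apply/seteqP; split.
  apply: smallest_sub; first exact: smallest_sigma_algebra.
  move=> O /open_labsP oO.
  have -> : O = \bigcup_n \bigcup_(i in [set i | cball (e i) (qi ^+ n) `<=` O])
      cball (e i) (qi ^+ n).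
    apply/seteqP; split => [x /oO[n nO]|x [n _ [i /= iO]] /iO//].
    have [i xi] := eP x n; exists n => //; exists i => //=.
    by rewrite (closed_ball_at_center xi) => y; rewrite /cball/= labsB => /nO.
  apply: (@bigcupT_measurable _ (g_sigma_algebraType ball_system)) => n.
  apply: (@bigcup_measurable _ (g_sigma_algebraType ball_system)) => i _.
  by apply: sub_sigma_algebra; right; exists (e i), n.
apply: smallest_sub; first exact: smallest_sigma_algebra.
move=> _ [->|[c [n ->]]]; first exact: measurable0.
by apply: measurable_closed_ball_at; rewrite exprn_gt0 ?qi0.
Qed.

(** * Borel measurability of the field operations and of the absolute value *)

Section MeasurableFun.
Context d (T : measurableType d).

(** Separability is essential: it makes the preimage of an open set under [op] a countable union of
    rectangles of balls, on which measurability of [f] and [g] separately suffices. *)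
Lemma measurable_fun_continuous_op (op : F -> F -> F) (f g : T -> borel F) :
  (forall x y n, exists m, forall x' y', labs (x - x') <= qi ^+ m ->
     labs (y - y') <= qi ^+ m -> labs (op x y - op x' y') <= qi ^+ n) ->
  measurable_fun setT f -> measurable_fun setT g ->
  measurable_fun setT (fun t => op (f t) (g t) : borel F).
Proof.
move=> opc mf mg.
apply: (@measurability _ _ T (borel F) setT _ (open : set (set (pointed_field F))) erefl).
move=> _ [U /open_labsP oO <-]; rewrite setTI.
have [e eP] := @local_field_dense R F.
rewrite (_ : _ @^-1` U = \bigcup_m \bigcup_i \bigcup_(j in
    [set j | forall x y, cball (e i) (qi ^+ m) x -> cball (e j) (qi ^+ m) y ->
       U (op x y)])
    (f @^-1` cball (e i) (qi ^+ m) `&` g @^-1` cball (e j) (qi ^+ m))).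
  apply: bigcupT_measurable => m; apply: bigcupT_measurable => i.
  apply: bigcup_measurable => j _.
  have mb c : measurable (cball c (qi ^+ m)).
    by apply: measurable_closed_ball_at; rewrite exprn_gt0 ?qi0.
  by apply: measurableI; rewrite -[_ @^-1` _]setTI; [exact: mf|exact: mg].
apply/seteqP; split => [t /oO[n nO]|t [m _ [i _ [j /= ij [fi gj]]]]]; last exact: ij.
have [m mP] := opc (f t) (g t) n.
have [i fi] := eP (f t) m; have [j gj] := eP (g t) m.
exists m => //; exists i => //; exists j => //= x y.
rewrite (closed_ball_at_center fi) (closed_ball_at_center gj) /cball /= => xf yg.
by apply: nO; apply: mP; rewrite labsB.
Qed.

Lemma measurable_fun_fieldD (f g : T -> borel F) :
  measurable_fun setT f -> measurable_fun setT g ->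
  measurable_fun setT (fun t => (f t : F) + (g t : F) : borel F).
Proof.
apply: (measurable_fun_continuous_op (op := fun x y => x + y)) => x y n.
exists n => x' y' hx hy; have -> : x + y - (x' + y') = (x - x') + (y - y') by ring.
exact: labsD_le.
Qed.

Lemma measurable_fun_fieldB (f g : T -> borel F) :
  measurable_fun setT f -> measurable_fun setT g ->
  measurable_fun setT (fun t => (f t : F) - (g t : F) : borel F).
Proof.
apply: (measurable_fun_continuous_op (op := fun x y => x - y)) => x y n.
exists n => x' y' hx hy; have -> : x - y - (x' - y') = (x - x') - (y - y') by ring.
exact: labsB_le.
Qed.

Lemma measurable_fun_fieldM (f g : T -> borel F) :
  measurable_fun setT f -> measurable_fun setT g ->
  measurable_fun setT (fun t => (f t : F) * (g t : F) : borel F).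
Proof.
apply: (measurable_fun_continuous_op (op := fun x y => x * y)) => x y n.
(* The extra [k] digits absorb the factors [|x|] and [|y|] in the two cross terms of the expansion
   below. *)
have [k kP] : exists k, qi ^+ k < (1 + labs x + labs y)^-1.
  by apply: residue_expr_small; rewrite invr_gt0 -addrA ltr_pwDl// addr_ge0// labs_ge0.
exists (n + k)%N => x' y' hx hy.
have lx := labs_ge0 x : (0 : R) <= _; have ly := labs_ge0 y : (0 : R) <= _.
have Z : (0 : R) < 1 + labs x + labs y by rewrite -addrA ltr_pwDl// addr_ge0.
have qn : 0 < qi ^+ n by rewrite exprn_gt0 ?qi0.
have B (z : F) : labs z <= 1 + labs x + labs y -> qi ^+ (n + k) * labs z <= qi ^+ n.
  move=> zZ; rewrite exprD -mulrA ler_piMr ?(ltW qn)//.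
  apply: (le_trans (ler_pM _ _ (ltW kP) zZ)); rewrite ?exprn_ge0 ?(ltW qi0) ?labs_ge0//.
  by rewrite mulVf ?gt_eqF.
have -> : x * y - x' * y' = (x - x') * y + ((y - y') * x - (x - x') * (y - y')).
  by ring.
apply: labsD_le; [|apply: labsB_le]; rewrite labsM.
- by apply: le_trans (B y _); [rewrite ler_wpM2r|lra].
- by apply: le_trans (B x _); [rewrite ler_wpM2r|lra].
- rewrite -[qi ^+ n]mulr1; apply: ler_pM; rewrite ?labs_ge0//.
    by apply: le_trans hx _; rewrite ler_wiXn2l ?(ltW qi0) ?(ltW qi1)// leq_addr.
  by apply: le_trans hy _; rewrite exprn_ile1 ?(ltW qi0) ?(ltW qi1).
Qed.

Lemma measurable_fun_labs (f : T -> borel F) :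
  measurable_fun setT f -> measurable_fun setT (fun t => labs (f t : F) : R).
Proof.
move=> mf; apply: (measurability _ (RGenInftyO.measurableE R)) => //.
move=> _ [_ [r ->] <-]; rewrite setTI.
rewrite (_ : _ @^-1` _ = f @^-1` [set x : F | labs x < r]); last first.
  by apply/seteqP; split => t /=; rewrite in_itv.
rewrite -[_ @^-1` _]setTI; apply: mf => //; apply: measurable_open.
apply/open_labsP => x /= xr.
have [->|x0] := eqVneq x 0.
  have r0 : 0 < r by apply: le_lt_trans xr; exact: labs_ge0.
  have [n nr] := residue_expr_small F r0; exists n => y.
  by rewrite sub0r labsN => /le_lt_trans; apply.
(* Away from [0] the absolute value is locally constant, by the isosceles property. *)
have [n nr] : exists n, qi ^+ n < labs x by apply: residue_expr_small; rewrite labs_gt0.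
exists n => y; rewrite labsB => /le_lt_trans/(_ nr) /labs_isosceles.
by rewrite addrC subrK => ->.
Qed.

Lemma measurable_labs_le (f : T -> borel F) (r : R) :
  measurable_fun setT f -> measurable [set t | labs (f t : F) <= r].
Proof.
move=> /measurable_fun_labs mf.
rewrite (_ : [set _ | _] = (fun t => labs (f t : F) : R) @^-1` `]-oo, r]%classic).
  by rewrite -[_ @^-1` _]setTI; apply: mf => //; exact: measurable_itv.
by apply/seteqP; split => t /=; rewrite in_itv.
Qed.

Lemma measurable_labs_eq (f : T -> borel F) (r : R) :
  measurable_fun setT f -> measurable [set t | labs (f t : F) = r].
Proof.
move=> /measurable_fun_labs mf.
rewrite (_ : [set _ | _] = (fun t => labs (f t : F) : R) @^-1` [set r])//.
by rewrite -[_ @^-1` _]setTI; apply: mf => //; exact: measurable_set1.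
Qed.

End MeasurableFun.

(** * Haar measure of balls and scaling by the uniformizer *)

Section HaarMeasure.
Variable mu : {sigma_finite_measure set (borel F) -> \bar R}.
Hypothesis hmu : normalized_haar mu.

Lemma haar_ball_translate c r : 0 < r -> mu (cball c r) = mu (cball 0 r).
Proof.
move=> r0; rewrite -(hmu.1 c _ (measurable_closed_ball_at 0 r0)).
congr (mu _); apply/seteqP; split => [x xc|_ [x /= xr <-]].
  by exists ((x : F) - c); rewrite /cball /= ?subr0// addrC subrK.
by move: xr; rewrite /cball /= subr0 [c + _]addrC addrK.
Qed.

(** The ball is the disjoint union of the [q] translates centred at [b * r i], one for each residue
    class, all of equal mass by invariance. *)
Lemma haar_ball_split (b : F) : b != 0 ->
  mu (cball 0 (labs b)) = (q%:R%:E * mu (cball (0 : F)%R (labs b * qi)))%E.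
Proof.
move=> b0; have [r [r1 rT rI]] := @residue_reps R F.
have bq0 : 0 < labs b * qi by rewrite mulr_gt0 ?labs_gt0 ?qi0.
pose G i := cball (b * r i) (labs b * qi).
have -> : cball 0 (labs b) = \bigcup_(i in `I_q) G i.
  apply/seteqP; split => [x|x [i /= iq]]; rewrite /G /cball /= subr0 => xb.
    have [|i iq xi] := rT (x / b).
      by rewrite labsM labsV ler_pdivrMr ?labs_gt0// mul1r.
    exists i => //=; have -> : x - b * r i = b * (x / b - r i).
      by rewrite mulrBr mulrCA divff// mulr1.
    by rewrite labsM ler_pM2l ?labs_gt0.
  rewrite -[x](subrK (b * r i)); apply: labsD_le.
    by apply: le_trans xb _; rewrite ler_piMr ?labs_ge0// ltW// qi1.
  by rewrite labsM ler_piMr ?labs_ge0.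
rewrite measure_fin_bigcup//; last first.
- by move=> i _; exact: measurable_closed_ball_at.
- move=> i j /= iq jq [x [xi xj]]; apply: rI => //.
  rewrite -(@ler_pM2l _ (labs b)) ?labs_gt0// -labsM mulrBr.
  have -> : b * r i - b * r j = (x - b * r j) - (x - b * r i) by ring.
  exact: labsB_le.
rewrite (eq_fsbigr (fun=> mu (cball 0 (labs b * qi)))); last first.
  by move=> i _; exact: haar_ball_translate.
by rewrite -fsbig_ord sumr_const card_ord mule_natl.
Qed.

Lemma haar_ball c n : mu (cball c (qi ^+ n)) = (qi ^+ n)%:E.
Proof.
rewrite haar_ball_translate ?exprn_gt0 ?qi0//.
elim: n => [|n IH].
  rewrite expr0 -hmu.2; congr (mu _).
  by apply/seteqP; split => x; rewrite /cball /= subr0.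
have q0 : (q%:R : R) != 0 by rewrite -invr_eq0 gt_eqF ?qi0.
have := @haar_ball_split (pi ^+ n) (expf_neq0 _ (uniformizer_neq0 F)).
rewrite labs_uniformizerX -exprSr IH => h.
have -> : (qi ^+ n.+1)%:E = (qi%:E * (qi ^+ n)%:E)%E by rewrite exprS EFinM.
by rewrite h muleA -EFinM mulVf// mul1e.
Qed.

(** Uniqueness of measures: [q] times the pushforward of [mu] under division by the uniformizer
    agrees with [mu] on balls, a generating pi-system, and countably many unit balls of finite mass
    cover the field. *)
Lemma haar_scale (B : set (borel F)) : measurable B ->
  mu ((fun x : borel F => (x : F) / pi : borel F) @^-1` B) = (qi%:E * mu B)%E.
Proof.
move=> mB; pose g : borel F -> borel F := fun x => (x : F) / pi.
change (mu (g @^-1` B) = (qi%:E * mu B)%E).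
have mg : measurable_fun setT g.
  by apply: measurable_fun_fieldM => //; exact: measurable_cst.
have [pf pfE] := pushforward_measure mu mg.
have q0 : (q%:R : R) != 0 by rewrite -invr_eq0 gt_eqF ?qi0.
pose nu : {measure set (borel F) -> \bar R} := mscale (NngNum (ler0n R q)) pf.
have nuE A : nu A = (q%:R%:E * mu (g @^-1` A))%E by rewrite /nu /= /mscale /= pfE.
have [e eP] := @local_field_dense R F.
have munu : mu B = nu B.
  apply: (measure_unique ball_system (fun k => cball (e k) (qi ^+ 0))) => //.
  - exact: ball_system_generates.
  - exact: ball_system_setI.
  - by move=> k; right; exists (e k), 0%N.
  - apply/seteqP; split => // x _; have [i xi] := eP x 0%N; exists i => //.
  - move=> _ [->|[c [n ->]]]; first by rewrite !measure0.
    rewrite nuE; have -> : g @^-1` (cball c (qi ^+ n)) = cball (c * pi) (qi ^+ n.+1).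
      apply/seteqP; split => x; rewrite /cball /g /=.
        have -> : (x : F) - c * pi = (x / pi - c) * pi.
          by rewrite mulrBl divfK// uniformizer_neq0.
        by rewrite labsM labs_uniformizer exprSr ler_pM2r// qi0.
      have -> : (x : F) / pi - c = (x - c * pi) / pi.
        by rewrite mulrBl mulfK// uniformizer_neq0.
      by rewrite labsM labsV labs_uniformizer ler_pdivrMr ?qi0// exprSr.
    apply: (etrans (haar_ball c n)); apply/esym.
    apply: (etrans (congr1 (mule q%:R%:E) (haar_ball (c * pi) n.+1))).
    by rewrite -EFinM exprS mulrA mulfV ?mul1r.
  - by move=> k; apply: le_lt_trans (ltry (qi ^+ 0)); rewrite -(haar_ball (e k) 0).
by rewrite munu nuE muleA -EFinM mulVf// mul1e.
Qed.

End HaarMeasure.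
End Haar.

(** * Volumes of the level sets *)

Section LevelSets.
Context (R : realType) (F : nonarchLocalFieldType R).

Local Notation q := (@residue_card R F).
Local Notation qi := ((@residue_card R F)%:R^-1 : R).
Local Notation pi := (@uniformizer R F).
Local Notation qi0 := (@residue_card_inv_gt0 R F).
Local Notation qi1 := (@residue_card_inv_lt1 R F).
Local Notation cball := closed_ball_at.

Lemma labs_lt_expr (x : F) n : (labs x < qi ^+ n) = (labs x <= qi ^+ n.+1).
Proof.
have p0 : 0 < qi ^+ n by rewrite exprn_gt0 ?qi0.
rewrite -[labs x](mulfVK (lt0r_neq0 p0)) -labs_uniformizerX -labsV -labsM.
rewrite gtr_pMl ?labs_uniformizerX// exprS ler_pM2r//.
exact: labs_lt1.
Qed.

Variable mu : {sigma_finite_measure set (borel F) -> \bar R}.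
Hypothesis hmu : normalized_haar mu.

Local Notation F2 := (borel F * borel F)%type.
Local Notation F3 := (borel F * borel F * borel F)%type.
Local Notation F4 := (borel F * borel F * borel F * borel F)%type.

(** The partial products inside [haar4], as plain measures. The product lemmas take any measure on
    the left and a sigma-finite one on the right, so the four variables are treated by adding one
    factor [mu] at a time. *)
Definition haar1 : {measure set (borel F) -> \bar R} := mu.
Definition haar2 : {measure set F2 -> \bar R} := (haar1 \x mu)%E.
Definition haar3 : {measure set F3 -> \bar R} := (haar2 \x mu)%E.

Lemma haar1_ball c n : haar1 (cball c (qi ^+ n)) = (qi ^+ n)%:E.
Proof. exact: haar_ball. Qed.

Lemma haar2X A B : measurable A -> measurable B ->
  haar2 (A `*` B) = (haar1 A * haar1 B)%E.
Proof. exact: product_measure1E. Qed.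

Lemma haar3X A B : measurable A -> measurable B ->
  haar3 (A `*` B) = (haar2 A * haar1 B)%E.
Proof. exact: product_measure1E. Qed.

Lemma haar4X A B : measurable A -> measurable B ->
  haar4 mu (A `*` B) = (haar3 A * haar1 B)%E.
Proof. exact: (product_measure1E haar3 mu). Qed.

Definition div_unif (x : borel F) : borel F := (x : F) / pi.

Lemma labs_div_unif x : labs (div_unif x : F) = labs (x : F) / qi :> R.
Proof. by rewrite labsM labsV labs_uniformizer. Qed.

Lemma labs_div_unif_le1 x : (labs (div_unif x : F) <= 1 :> R) = (labs (x : F) < 1 :> R).
Proof. by rewrite labs_div_unif ler_pdivrMr ?qi0// mul1r labs_lt1. Qed.

Lemma measurable_fun_div_unif : measurable_fun setT div_unif.
Proof. by apply: measurable_fun_fieldM => //; exact: measurable_cst. Qed.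

Lemma haar_shell i :
  haar1 [set z : borel F | labs (z : F) = qi ^+ i] = ((1 - qi) * qi ^+ i)%:E.
Proof.
have mb n : measurable (cball (0 : F) (qi ^+ n)).
  by apply: measurable_closed_ball_at; rewrite exprn_gt0 ?qi0.
have -> : [set z : borel F | labs (z : F) = qi ^+ i] =
    cball (0 : F) (qi ^+ i) `\` cball (0 : F) (qi ^+ i.+1).
  apply/seteqP; split => z; rewrite /cball /= subr0 -labs_lt_expr.
    by move=> ->; rewrite lexx ltxx.
  by move=> [h1 /negP]; rewrite -leNgt => h2; apply/eqP; rewrite eq_le h1.
rewrite measureD//; last first.
  by apply: le_lt_trans (ltry (qi ^+ i)); rewrite -(haar1_ball 0 i).
rewrite setIidr; last first.
  move=> z; rewrite /cball /= subr0 => /le_trans; apply.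
  by rewrite ler_wiXn2l ?(ltW qi0) ?(ltW qi1).
apply: (etrans (congr2 (fun a b => a - b)%E (haar1_ball 0 i) (haar1_ball 0 i.+1))).
by rewrite -EFinB exprS mulrBl mul1r.
Qed.

Section Form.
Variable p : F -> F -> F.
Hypothesis mp : measurable_fun setT (fun u : F2 => p u.1 u.2 : borel F).
Hypothesis two1 : labs (2 : F) = 1 :> R.
Hypothesis p_hom : forall a x y : F, p (x * a) (y * a) = p x y * a ^+ 2.

Definition quat (v : F4) : borel F := 2 * (v.1.2 : F) * (v.2 : F) - p v.1.1.1 v.1.1.2.

Definition integral2 : set F2 :=
  [set u | labs (u.1 : F) <= 1 :> R] `&` [set u | labs (u.2 : F) <= 1 :> R].

Definition integral4 : set F4 :=
  [set v | labs (v.1.1.1 : F) <= 1 :> R] `&` [set v | labs (v.1.1.2 : F) <= 1 :> R] `&`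
  [set v | labs (v.1.2 : F) <= 1 :> R] `&` [set v | labs (v.2 : F) <= 1 :> R].

Definition binary_ball (r : R) : set F2 :=
  integral2 `&` [set u | labs (p u.1 u.2) <= r].

Definition quat_ball (r : R) : set F4 := integral4 `&` [set v | labs (quat v : F) <= r].

Lemma measurable_fun_coord1 : measurable_fun setT (fun v : F4 => v.1.1.1).
Proof. by do 2 apply: measurableT_comp => //; exact: measurable_fst. Qed.

Lemma measurable_fun_coord2 : measurable_fun setT (fun v : F4 => v.1.1.2).
Proof. by do 2 apply: measurableT_comp => //; exact: measurable_fst. Qed.

Lemma measurable_fun_coord3 : measurable_fun setT (fun v : F4 => v.1.2).
Proof. by apply: measurableT_comp => //; exact: measurable_fst. Qed.

Lemma measurable_fun_coord4 : measurable_fun setT (fun v : F4 => v.2).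
Proof. exact: measurable_snd. Qed.

Lemma measurable_fun_quat : measurable_fun setT quat.
Proof.
apply: measurable_fun_fieldB.
  apply: measurable_fun_fieldM; last exact: measurable_fun_coord4.
  by apply: measurable_fun_fieldM; [exact: measurable_cst|exact: measurable_fun_coord3].
apply: (measurableT_comp mp (g := fun v : F4 => v.1.1)).
by apply: measurableT_comp => //; exact: measurable_fst.
Qed.

Lemma measurable_integral2 : measurable integral2.
Proof. by apply: measurableI; apply: measurable_labs_le; [exact: measurable_fst|exact: measurable_snd]. Qed.

Lemma measurable_integral4 : measurable integral4.
Proof.
by do ![apply: measurableI]; apply: measurable_labs_le;
  [exact: measurable_fun_coord1|exact: measurable_fun_coord2|exact: measurable_fun_coord3|exact: measurable_fun_coord4].
Qed.

Lemma measurable_binary_ball r : measurable (binary_ball r).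
Proof.
by apply: measurableI; [exact: measurable_integral2|exact: measurable_labs_le].
Qed.

Lemma measurable_quat_ball r : measurable (quat_ball r).
Proof.
apply: measurableI; [exact: measurable_integral4|apply: measurable_labs_le].
exact: measurable_fun_quat.
Qed.

Lemma haar_integers : haar1 (cball (0 : F) 1) = 1%E.
Proof. by rewrite -(expr0 qi) haar1_ball expr0. Qed.

Lemma measure_integral2 : haar2 integral2 = 1%E.
Proof.
have -> : integral2 = cball (0 : F) 1 `*` cball (0 : F) 1.
  by apply/seteqP; split => u; rewrite /integral2 /cball /= !subr0.
by rewrite haar2X ?haar_integers ?mule1//; exact: measurable_closed_ball_at.
Qed.

Lemma measure_integral4 : haar4 mu integral4 = 1%E.
Proof.
have mB : measurable (cball (0 : F) 1) by exact: measurable_closed_ball_at.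
have -> : integral4 = integral2 `*` cball (0 : F) 1 `*` cball (0 : F) 1.
  by apply/seteqP; split => u; rewrite /integral4 /integral2 /cball /= !subr0;
    move=> [[]].
have mI := measurable_integral2.
rewrite haar4X ?haar3X ?haar_integers ?mule1//; first exact: measure_integral2.
exact: measurableX.
Qed.

Lemma haar1_scale B : measurable B ->
  haar1 (div_unif @^-1` B) = (qi%:E * haar1 B)%E.
Proof. exact: haar_scale. Qed.

Lemma measurable_fun_div_unif2 :
  measurable_fun setT (fun u : F2 => (div_unif u.1, div_unif u.2)).
Proof.
by apply: measurable_fun_pair; apply: (measurableT_comp measurable_fun_div_unif);
  [exact: measurable_fst|exact: measurable_snd].
Qed.

Lemma measurable_fun_div_unif3 : measurable_fun setT
  (fun u : F3 => ((div_unif u.1.1, div_unif u.1.2), div_unif u.2)).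
Proof.
apply: measurable_fun_pair.
  by apply: (measurableT_comp measurable_fun_div_unif2); exact: measurable_fst.
by apply: (measurableT_comp measurable_fun_div_unif); exact: measurable_snd.
Qed.

Lemma measure_scale2 (B : set F2) : measurable B ->
  haar2 ((fun u => (div_unif u.1, div_unif u.2)) @^-1` B) = ((qi ^+ 2)%:E * haar2 B)%E.
Proof.
move=> mB; exact: (product_measure_scale (m1 := haar1) (m2 := mu)
  (a1 := NngNum (ltW qi0)) (a2 := NngNum (ltW qi0)) measurable_fun_div_unif
  haar1_scale haar1_scale mB).
Qed.

Definition div_unif4 (v : F4) : F4 :=
  (div_unif v.1.1.1, div_unif v.1.1.2, div_unif v.1.2, div_unif v.2).

Lemma measure_scale4 (B : set F4) : measurable B ->
  haar4 mu (div_unif4 @^-1` B) = ((qi ^+ 4)%:E * haar4 mu B)%E.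
Proof.
have qin n : 0 <= qi ^+ n by rewrite exprn_ge0 ?(ltW qi0).
have s3 (C : set F3) : measurable C -> haar3 ((fun u : F3 =>
    ((div_unif u.1.1, div_unif u.1.2), div_unif u.2)) @^-1` C) = ((qi ^+ 3)%:E * haar3 C)%E.
  move=> mC; rewrite [qi ^+ 3]exprSr.
  exact: (product_measure_scale (m1 := haar2) (m2 := mu)
    (a1 := NngNum (qin 2%N)) (a2 := NngNum (ltW qi0)) measurable_fun_div_unif2
    measure_scale2 haar1_scale mC).
move=> mB; rewrite [qi ^+ 4]exprSr.
exact: (product_measure_scale (m1 := haar3) (m2 := mu)
    (a1 := NngNum (qin 3%N)) (a2 := NngNum (ltW qi0)) measurable_fun_div_unif3
    s3 haar1_scale mB).
Qed.

(* Shells [|z| = qi ^ i] with [i <= k]: the condition on [t] cuts out a ball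
   of radius [qi ^ (k - i)], provided [|p (x, y)| <= qi ^ i]. *)
Lemma measure_shell i k : (i <= k)%N ->
  haar4 mu (quat_ball (qi ^+ k) `&` [set v | labs (v.1.2 : F) = qi ^+ i]) =
  (haar2 (binary_ball (qi ^+ i)) * ((1 - qi) * qi ^+ k)%:E)%E.
Proof.
move=> ik.
have q_gt0 n : 0 < qi ^+ n by rewrite exprn_gt0 ?qi0.
pose A := binary_ball (qi ^+ i) `*` [set z : borel F | labs (z : F) = qi ^+ i].
have mshell : measurable [set z : borel F | labs (z : F) = qi ^+ i].
  by apply: (measurable_labs_eq (f := id)).
have mA : measurable A by apply: measurableX => //; exact: measurable_binary_ball.
have split_ineq (x y z t : F) : labs z = qi ^+ i :> R -> labs (p x y) <= qi ^+ i ->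
    labs (2 * z * t - p x y) = qi ^+ i * labs (t - p x y / (2 * z)) :> R.
  move=> zi _; have z0 : z != 0 by rewrite -(@labs_gt0 R) zi.
  have t0 : (2 : F) != 0 by rewrite -(@labs_gt0 R) two1.
  rewrite -zi -[labs z]mul1r -two1 -!labsM mulrBr [2 * z * (_ / _)]mulrC divfK//.
  by rewrite mulf_neq0.
apply: (etrans (@product_measure_const_section _ _ _ _ _ haar3 mu _ A ((qi ^+ (k - i))%:E) _ _ _ _ _)).
- apply: measurableI; [exact: measurable_quat_ball|apply: measurable_labs_eq].
  exact: measurable_fun_coord3.
- exact: mA.
- by rewrite lee_fin ltW.
- move=> [[x y] z] [[/= [x1 y1] pxy] zi].
  rewrite -(haar1_ball (p x y / (2 * z)) (k - i)); congr (haar1 _).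
  have z0 : labs (2 * (z : F)) = qi ^+ i :> R by rewrite labsM two1 mul1r.
  have kk : qi ^+ k = qi ^+ i * qi ^+ (k - i) by rewrite -exprD subnKC.
  apply/seteqP; split => t; rewrite /xsection /cball /quat_ball /integral4 /quat /= inE /=.
    by move=> [[_]]; rewrite split_ineq// kk ler_pM2l.
  move=> tb; split; last by rewrite zi.
  rewrite split_ineq// kk ler_pM2l//; split => //; split => //.
    by rewrite /= zi exprn_ile1 ?(ltW qi0) ?(ltW qi1).
  rewrite -[t](subrK (p x y / (2 * z))); apply: labsD_le.
    by apply: le_trans tb _; rewrite exprn_ile1 ?(ltW qi0) ?(ltW qi1).
  by rewrite labsM labsV z0 ler_pdivrMr// mul1r.
- move=> [[x y] z] t [[[[[/= x1 y1] z1] t1] qk] zi]; split => //; split => //=.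
  have -> : p x y = 2 * z * t - (2 * z * t - p x y) by rewrite opprB addrC subrK.
  apply: labsB_le.
    by rewrite !labsM two1 mul1r zi ler_piMr ?(ltW (q_gt0 _)).
  by apply: le_trans qk _; rewrite ler_wiXn2l ?(ltW qi0) ?(ltW qi1).
- rewrite /A haar3X//; last exact: measurable_binary_ball.
  rewrite haar_shell -muleA -EFinM; congr (_ * _%:E)%E.
  by rewrite -mulrA -exprD subnKC.
Qed.

(** For such small [z] the term [2 z t] is negligible for every integral [t], so the condition on
    [Q] becomes one on [p] alone and the set is a product. *)
Lemma measure_core k :
  haar4 mu (quat_ball (qi ^+ k) `&` [set v | labs (v.1.2 : F) <= qi ^+ k.+1]) =
  (haar2 (binary_ball (qi ^+ k)) * (qi ^+ k.+1)%:E)%E.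
Proof.
have -> : quat_ball (qi ^+ k) `&` [set v | labs (v.1.2 : F) <= qi ^+ k.+1] =
    binary_ball (qi ^+ k) `*` cball (0 : F) (qi ^+ k.+1) `*` cball (0 : F) 1.
  apply/seteqP; split => [[[[x y] z] t]|[[[x y] z] t]]; rewrite /cball /quat_ball
      /integral4 /binary_ball /integral2 /quat /= !subr0.
    move=> [[[[[x1 y1] z1] t1] qk] zi]; split => //; split => //; split => //.
    have -> : p x y = 2 * z * t - (2 * z * t - p x y) by rewrite opprB addrC subrK.
    apply: labsB_le => //; rewrite !labsM two1 mul1r.
    apply: (le_trans (ler_piMr _ t1)); first exact: labs_ge0.
    by apply: le_trans zi _; rewrite ler_wiXn2l ?(ltW qi0) ?(ltW qi1).
  move=> [[[[x1 y1] pk] zi] t1]; split => //.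
  have zk : labs (z : F) <= qi ^+ k.
    by apply: le_trans zi _; rewrite ler_wiXn2l ?(ltW qi0) ?(ltW qi1).
  split; [split => //; split => //|].
    by apply: le_trans zi _; rewrite exprn_ile1 ?(ltW qi0) ?(ltW qi1).
  apply: labsB_le => //; rewrite !labsM two1 mul1r.
  by apply: (le_trans (ler_piMr _ t1)); first exact: labs_ge0.
have mb n : measurable (cball (0 : F) (qi ^+ n)).
  by apply: measurable_closed_ball_at; rewrite exprn_gt0 ?qi0.
have mb1 : measurable (cball (0 : F) 1) by exact: measurable_closed_ball_at.
have m2 := @measurable_binary_ball (qi ^+ k).
rewrite haar4X//; last exact: measurableX.
by rewrite haar_integers mule1 haar3X// haar1_ball.
Qed.

Definition binary_volume (n : nat) : R := fine (haar2 (binary_ball (qi ^+ n))).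

Lemma binary_volumeE n : haar2 (binary_ball (qi ^+ n)) = (binary_volume n)%:E.
Proof.
rewrite /binary_volume fineK// ge0_fin_numE//.
apply: le_lt_trans (ltry 1); rewrite -measure_integral2.
apply: le_measure; rewrite ?inE; first exact: measurable_binary_ball.
  exact: measurable_integral2.
exact: subIsetl.
Qed.

Lemma measure_quat_ball k : haar4 mu (quat_ball (qi ^+ k)) =
  (qi ^+ k * ((1 - qi) * \sum_(i < k.+1) binary_volume i + qi * binary_volume k))%:E.
Proof.
pose S j := quat_ball (qi ^+ k) `&` [set v | labs (v.1.2 : F) <= qi ^+ j].
have mS j : measurable (S j).
  apply: measurableI; [exact: measurable_quat_ball|apply: measurable_labs_le].
  exact: measurable_fun_coord3.
(* The shells [|z| = q ^ -i] are peeled off one at a time; what remains after [k.+1] of them is the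
   set of [measure_core]. *)
suff h j : (j <= k.+1)%N -> haar4 mu (quat_ball (qi ^+ k)) =
    ((\sum_(i < j) binary_volume i * ((1 - qi) * qi ^+ k))%:E + haar4 mu (S j))%E.
  rewrite (h k.+1)// measure_core binary_volumeE -EFinM -EFinD -mulr_suml exprS.
  by congr EFin; ring.
elim: j => [_|j IH jk].
  rewrite big_ord0 add0e; congr (haar4 mu _); rewrite /S setIidl//.
  by move=> v [[[_ z1] _] _] /=; rewrite expr0.
rewrite (IH (ltnW jk)) big_ord_recr /= EFinD -addeA; congr (_ + _)%E.
have -> : S j = (quat_ball (qi ^+ k) `&` [set v | labs (v.1.2 : F) = qi ^+ j]) `|` S j.+1.
  rewrite /S -setIUr; congr (_ `&` _); apply/seteqP; split => v /=.
    rewrite -labs_lt_expr le_eqVlt => /orP[/eqP|]; [by left|by right].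
  by move=> [->|]//; rewrite -labs_lt_expr => /ltW.
rewrite measureU//.
- have e := @measure_shell j k jk; rewrite binary_volumeE -EFinM in e.
  by congr (_ + _)%E; exact: e.
- apply: measurableI; [exact: measurable_quat_ball|apply: measurable_labs_eq].
  exact: measurable_fun_coord3.
- rewrite -subset0 => v [[_ /= vj] [_ /=]]; rewrite -labs_lt_expr vj.
  by rewrite ltxx.
Qed.

(** A pair with [|p|] this small cannot be primitive, so it is the uniformizer times an integral
    pair. Since [p] has degree [2], division lowers the exponent by [2], while the area changes by
    [qi ^+ 2]. *)
Lemma binary_volume_rec K n : (K <= n)%N ->
  (forall x y, labs x <= 1 :> R -> labs y <= 1 :> R -> labs x = 1 :> R \/ labs y = 1 :> R ->
     qi ^+ K < labs (p x y)) ->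
  binary_volume n.+2 = qi ^+ 2 * binary_volume n.
Proof.
move=> Kn pK; apply: EFin_inj; rewrite EFinM -!binary_volumeE -measure_scale2; last first.
  exact: measurable_binary_ball.
have q2 : 0 < qi ^+ 2 by rewrite exprn_gt0 ?qi0.
have pE (x y : F) : (labs (p x y) <= qi ^+ n.+2) = (labs (p (x / pi) (y / pi)) <= qi ^+ n).
  rewrite p_hom labsM labsX labsV labs_uniformizer [qi^-1 ^+ 2]exprVn.
  by rewrite ler_pdivrMr// -exprD addn2.
congr (haar2 _); apply/seteqP; split => -[x y];
    rewrite /binary_ball /integral2 /= !labs_div_unif_le1 -pE.
  move=> [[x1 y1] pn]; split => //; split; rewrite lt_neqAle ?x1 ?y1 andbT;
    apply/negP => /eqP h; have : qi ^+ K < labs (p x y) by apply: pK; auto.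
    rewrite ltNge (le_trans pn)// ler_wiXn2l ?(ltW qi0) ?(ltW qi1)//.
    by rewrite (leq_trans Kn)// leqW.
  rewrite ltNge (le_trans pn)// ler_wiXn2l ?(ltW qi0) ?(ltW qi1)//.
  by rewrite (leq_trans Kn)// leqW.
by move=> [[/ltW x1 /ltW y1] pn].
Qed.

Lemma primitive_vectorsE : @primitive_vectors R F =
  integral4 `&` ~` (div_unif4 @^-1` integral4).
Proof.
have E (a b : bool) (P : Prop) : (P <-> a && ~~ b) -> P = (a /\ ~ b).
  by move=> h; apply/propext; rewrite h; split => [/andP[? /negP]|[? /negP ?]]//; apply/andP.
apply/seteqP; split => -[[[x y] z] t];
    rewrite /primitive_vectors /integral4 /div_unif4 /= !labs_div_unif_le1.
  move=> h; split.
    by move: (lexx (1 : R)); rewrite -{1}h !ge_max => /andP[/andP[/andP[]]].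
  move=> [[[x1 y1] z1] t1]; move: (ltxx (1 : R)).
  by rewrite -{1}h !gt_max x1 y1 z1 t1.
move=> [[[[x1 y1] z1] t1] h]; apply/eqP; rewrite eq_le; apply/andP; split.
  by rewrite !ge_max x1 y1 z1 t1.
rewrite leNgt !gt_max; apply/negP => /andP[/andP[/andP[? ?] ?] ?].
exact: h.
Qed.

Lemma measurable_div_unif4 (B : set F4) : measurable B -> measurable (div_unif4 @^-1` B).
Proof.
move=> mB; rewrite -[_ @^-1` _]setTI; apply: (_ : measurable_fun setT div_unif4) => //.
apply: measurable_fun_pair.
  by apply: (measurableT_comp measurable_fun_div_unif3); exact: measurable_fst.
by apply: (measurableT_comp measurable_fun_div_unif); exact: measurable_snd.
Qed.

Lemma measurable_primitive_vectors : measurable (@primitive_vectors R F).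
Proof.
rewrite primitive_vectorsE; apply: measurableI; first exact: measurable_integral4.
exact: (measurableC (measurable_div_unif4 measurable_integral4)).
Qed.

Definition primitive_ball (r : R) : set F4 :=
  @primitive_vectors R F `&` [set v | labs (quat v : F) <= r].

Lemma measurable_primitive_ball r : measurable (primitive_ball r).
Proof.
apply: measurableI; [exact: measurable_primitive_vectors|apply: measurable_labs_le].
exact: measurable_fun_quat.
Qed.

Definition quat_volume (r : R) : R := fine (haar4 mu (quat_ball r)).

Lemma quat_volumeE r : haar4 mu (quat_ball r) = (quat_volume r)%:E.
Proof.
rewrite /quat_volume fineK// ge0_fin_numE//.
apply: le_lt_trans (ltry 1); rewrite -measure_integral4.
apply: le_measure; rewrite ?inE; first exact: measurable_quat_ball.
  exact: measurable_integral4.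
exact: subIsetl.
Qed.

(* The integral vectors that are not primitive are the multiples of the
   uniformizer. *)
Lemma measure_primitive_ball r :
  haar4 mu (primitive_ball r) = (quat_volume r - qi ^+ 4 * quat_volume (r / qi ^+ 2))%:E.
Proof.
have q2 : 0 < qi ^+ 2 by rewrite exprn_gt0 ?qi0.
have quat_div v : labs (quat (div_unif4 v) : F) = labs (quat v : F) / qi ^+ 2 :> R.
  rewrite -exprVn -(labs_uniformizer (s := F)) -labsV -labsX -labsM; congr labs.
  by rewrite /quat /div_unif4 /div_unif /= p_hom; ring.
pose S := div_unif4 @^-1` quat_ball (r / qi ^+ 2).
have mS : measurable S := measurable_div_unif4 (measurable_quat_ball _).
have SE : quat_ball r = primitive_ball r `|` S.
  rewrite /primitive_ball primitive_vectorsE /S /quat_ball.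
  apply/seteqP; split => v /=; rewrite quat_div ler_pM2r ?invr_gt0//.
    move=> [v4 vr]; have [h|h] := pselect (integral4 (div_unif4 v)); [by right|by left].
  move=> [[[v4 _] vr]//|[v4 vr]]; split => //.
  move: v4; rewrite /integral4 /div_unif4 /= !labs_div_unif_le1.
  by move=> [[[/ltW ? /ltW ?] /ltW ?] /ltW ?].
have dis : primitive_ball r `&` S = set0.
  by rewrite -subset0 /primitive_ball primitive_vectorsE => v [[[_ h] _] [/h]].
have e : haar4 mu (quat_ball r) = (haar4 mu (primitive_ball r) + haar4 mu S)%E.
  rewrite SE; apply: measureU => //; exact: measurable_primitive_ball.
have eS : haar4 mu S = (qi ^+ 4 * quat_volume (r / qi ^+ 2))%:E.
  rewrite /S measure_scale4; last exact: measurable_quat_ball.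
  by rewrite quat_volumeE -EFinM.
by rewrite EFinB -eS -quat_volumeE e eS addeK.
Qed.

End Form.
End LevelSets.

(** * The binary form *)

Definition binary (F : fieldType) (A b c x y : F) : F :=
  b * (y ^+ 2 + A * x ^+ 2) + c * x * y.

Section BinaryForm.
Context (R : realType) (F : nonarchLocalFieldType R).

Local Notation q := (@residue_card R F).
Local Notation qi := ((@residue_card R F)%:R^-1 : R).
Local Notation pi := (@uniformizer R F).
Local Notation qi0 := (@residue_card_inv_gt0 R F).
Local Notation qi1 := (@residue_card_inv_lt1 R F).

(** If [|2| < 1] then [2] vanishes in the residue field, which then has characteristic [2]. Odd
    residual characteristic enters the proof only here. *)
Lemma labs_two : odd_residual_char F -> labs (2 : F) = 1 :> R.
Proof.
move=> hF; apply/eqP; rewrite eq_le; apply/andP; split.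
  by apply: labsD_le; rewrite labs1.
rewrite leNgt; apply/negP => h2.
suff /hF : 2%N \in [pchar (residue_field F)] by [].
rewrite inE /=.
have -> : (2%:R : residue_field F) = (\pi_(residue_field F) (2 : integer_ring F))%qT.
  by rewrite rmorph_nat.
rewrite -(rmorph0 (\pi_(residue_field F))%qT) -Quotient.idealrBE subr0 inE.
exact: h2.
Qed.

Variables A b c : F.
Local Notation binary := (binary A b c).

Lemma binary_hom (a x y : F) : binary (x * a) (y * a) = binary x y * a ^+ 2.
Proof. by rewrite /binary; ring. Qed.

Lemma measurable_fun_binary :
  measurable_fun setT (fun u : borel F * borel F => binary u.1 u.2 : borel F).
Proof.
have m1 := @measurable_fst _ _ (borel F) (borel F).
have m2 := @measurable_snd _ _ (borel F) (borel F).
have mc (a : borel F) : measurable_fun setT (fun _ : borel F * borel F => a).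
  exact: measurable_cst.
have y2 := measurable_fun_fieldM m2 m2.
have x2 := measurable_fun_fieldM (mc A) (measurable_fun_fieldM m1 m1).
have xy := measurable_fun_fieldM (measurable_fun_fieldM (mc c) m1) m2.
have h := measurable_fun_fieldD (measurable_fun_fieldM (mc b) (measurable_fun_fieldD y2 x2)) xy.
rewrite (_ : (fun u : borel F * borel F => _) = fun u : borel F * borel F =>
  b * ((u.2 : F) * (u.2 : F) + A * ((u.1 : F) * (u.1 : F))) + c * (u.1 : F) * (u.2 : F)).
  exact: h.
by apply/funext => u; rewrite /binary !expr2.
Qed.

Lemma binary_lipschitz : exists C, forall x y x' y' (d : R),
  labs x <= 1 :> R -> labs y <= 1 :> R -> labs x' <= 1 :> R -> labs y' <= 1 :> R ->
  labs (x - x') <= d -> labs (y - y') <= d ->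
  labs (binary x y - binary x' y') <= d / qi ^+ C.
Proof.
have [C [Cb CA Cc]] : exists C,
    [/\ labs b * qi ^+ C <= 1, labs (b * A) * qi ^+ C <= 1 & labs c * qi ^+ C <= 1].
  pose M : R := 1 + labs b + labs (b * A) + labs c.
  have lb : (0 : R) <= labs b by exact: labs_ge0.
  have lA : (0 : R) <= labs (b * A) by exact: labs_ge0.
  have lc : (0 : R) <= labs c by exact: labs_ge0.
  have M0 : 0 < M by rewrite /M; lra.
  have [C CM] : exists C, qi ^+ C < M^-1 by apply: residue_expr_small; rewrite invr_gt0.
  have H (l : R) : 0 <= l -> l <= M -> l * qi ^+ C <= 1.
    move=> l0 lM; apply: (@le_trans _ _ (M * M^-1)).
      by apply: ler_pM => //; rewrite ?exprn_ge0 ?(ltW qi0)// ltW.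
    by rewrite divff ?gt_eqF.
  by exists C; split; apply: H => //; rewrite /M; lra.
exists C => x y x' y' d x1 y1 x'1 y'1 xx yy.
have qC : 0 < qi ^+ C by rewrite exprn_gt0 ?qi0.
have d0 : 0 <= d by apply: le_trans xx; exact: labs_ge0.
rewrite ler_pdivlMr//.
have -> : binary x y - binary x' y' = b * ((y - y') * (y + y')) +
    (b * A * ((x - x') * (x + x')) + (c * ((x - x') * y) + c * ((y - y') * x'))).
  by rewrite /binary; ring.
have E (k u w : F) : labs k * qi ^+ C <= 1 -> labs u <= d -> labs w <= 1 :> R ->
    labs (k * (u * w)) <= d / qi ^+ C.
  move=> kC ud w1; rewrite ler_pdivlMr// labsM mulrAC -[d]mul1r.
  apply: ler_pM => //; rewrite ?mulr_ge0 ?labs_ge0 ?(ltW qC)//.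
  by rewrite labsM -[d]mulr1; apply: ler_pM; rewrite ?labs_ge0.
rewrite -ler_pdivlMr//.
apply: labsD_le; last apply: labsD_le; last apply: labsD_le; apply: E => //; exact: labsD_le.
Qed.

Lemma binary_bound : exists C, forall x y,
  labs x <= 1 :> R -> labs y <= 1 :> R -> labs (binary x y) <= (qi ^+ C)^-1.
Proof.
have [C CP] := binary_lipschitz; exists C => x y x1 y1.
have := CP x y 0 0 1 x1 y1; rewrite !subr0 labs0 ler01 div1r => /(_ isT isT x1 y1).
by rewrite (_ : binary 0 0 = 0) ?subr0// /binary; ring.
Qed.

Lemma ultra_fmap (T T' : Type) (f : T -> T') (G : set_system T) :
  UltraFilter G -> UltraFilter (f @ G).
Proof.
move=> GU; split; first exact: fmap_proper_filter.
move=> H HF GH; rewrite predeqE => B; split; last exact: GH.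
move=> HB; have [//|GnB] := in_ultra_setVsetC (f @^-1` B) GU.
have /(filterI HB)/filter_ex[x []] : H (~` B) by exact: GH.
by [].
Qed.

(* By compactness of the set of primitive pairs, reached through a limit along
   an ultrafilter on [nat]. *)
Lemma binary_lower_bound :
  (forall x y, binary x y = 0 -> x = 0 /\ y = 0) ->
  exists K, forall x y, labs x <= 1 :> R -> labs y <= 1 :> R ->
    labs x = 1 :> R \/ labs y = 1 :> R -> qi ^+ K < labs (binary x y).
Proof.
move=> aniso; apply: contrapT => /forallNP hN.
have /choice[s sP] : forall k, exists u : F * F, [/\ labs u.1 <= 1 :> R,
    labs u.2 <= 1 :> R, labs u.1 = 1 :> R \/ labs u.2 = 1 :> R
    & labs (binary u.1 u.2) <= qi ^+ k].
  move=> k; apply: contrapT => /forallNP h; apply: (hN k) => x y x1 y1 xy.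
  by rewrite ltNge; apply/negP => xyk; apply: (h (x, y)).
have [U [UU Uoo]] := @ultraFilterLemma nat \oo _.
have [C CP] := binary_lipschitz.
have lim (f : nat -> F) : (forall k, labs (f k) <= 1 :> R) ->
    exists2 l, labs l <= 1 :> R & forall n, U [set k | labs (l - f k) <= qi ^+ n].
  move=> f1; have fU : UltraFilter (f @ U) by exact: ultra_fmap.
  have [|l fl] := @integer_ultra_cvg R F (f @ U) fU.
    by apply: (@filterS _ U _ setT) filterT => k _ /=; exact: f1.
  have lU n : U [set k | labs (l - f k) <= qi ^+ n].
    have : nbhs l [set y | labs (l - y) <= qi ^+ n].
      by apply/nbhs_labsP; exists (qi ^+ n); rewrite ?exprn_gt0 ?qi0// => y /ltW.
    by move/fl.
  exists l => //; have [k /= kl] := filter_ex (lU 0%N).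
  by rewrite -[l](subrK (f k)); apply: labsD_le.
have [lx lx1 lxU] := lim (fun k => (s k).1) (fun k => let: And4 h _ _ _ := sP k in h).
have [ly ly1 lyU] := lim (fun k => (s k).2) (fun k => let: And4 _ h _ _ := sP k in h).
have : binary lx ly = 0.
  apply/eqP; rewrite -(@labs_eq0 R) eq_le labs_ge0 andbT leNgt; apply/negP => e0.
  have [n ne] := residue_expr_small F e0.
  have [k [[/= kx ky] nk]] := filter_ex (filterI (filterI (lxU (n + C)%N) (lyU (n + C)%N))
    (Uoo _ (nbhs_infty_ge n))).
  have [x1 y1 _ kp] := sP k.
  move: ne; rewrite ltNge => /negP; apply.
  rewrite -[binary lx ly](subrK (binary (s k).1 (s k).2)); apply: labsD_le.
    apply: le_trans (CP _ _ _ _ _ lx1 ly1 x1 y1 kx ky) _.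
    by rewrite exprD mulfK// expf_neq0// gt_eqF ?qi0.
  by apply: le_trans kp _; rewrite ler_wiXn2l ?(ltW qi0) ?(ltW qi1).
move=> /aniso[lx0 ly0].
(* A zero limit contradicts primitivity: some pair of the sequence has both coordinates of absolute
   value at most [1 / q]. *)
have [k [/= kx ky]] := filter_ex (filterI (lxU 1%N) (lyU 1%N)).
move: kx ky; rewrite lx0 ly0 !sub0r !labsN expr1 -!labs_lt1.
by have [_ _ [->|->] _] := sP k; rewrite ltxx.
Qed.

End BinaryForm.

(** * Recurrences and integrals of piecewise constant functions *)

Section VolumeRecurrence.
Context (R : realType).
Variables (q : R) (N : nat -> R) (J : nat).
Hypothesis q1 : 1 < q.

(* The volumes of the shells of primitive vectors, in terms of the volumes [N]
   of the balls [|Q| <= q ^ (C - j)] of integral vectors.  For [j < 2] the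
   truncated subtraction is harmless: [N 0] is already the total volume. *)
Definition primitive_shell (j : nat) : R :=
  (N j - q ^- 4 * N (j - 2)) - (N j.+1 - q ^- 4 * N (j.+1 - 2)).

Hypothesis N_rec : forall j, (J <= j)%N ->
  N j.+2 = q ^- 3 * N j + (q^-1 - q ^- 2) * N j.+1.

Let q_neq0 : q != 0.
Proof. by rewrite gt_eqF// (lt_trans _ q1). Qed.

(** The start [J.+2] leaves room for the index [j - 2]: from there on every volume involved obeys
    the recurrence, and the combination removes its root [- q ^ -2]. *)
Lemma primitive_shell_geometric k : primitive_shell (J.+2 + k) =
  primitive_shell J.+2 * q ^- k.
Proof.
have h j : (J <= j)%N -> primitive_shell j.+3 = primitive_shell j.+2 * q^-1.
  move=> Jj; rewrite /primitive_shell !subSS !subn0 /=.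
  rewrite (N_rec (leqW (leqW Jj))) (N_rec (leqW Jj)) (N_rec Jj).
  by field.
elim: k => [|k IH]; first by rewrite addn0 expr0 invr1 mulr1.
rewrite addnS -[(J.+2 + k).+1]/((J + k).+3) h ?leq_addr// -[(J + k).+2]/(J.+2 + k)%N IH.
by rewrite exprSr invfM mulrA.
Qed.

(* Here the vanishing at [s = 0] happens: the sum telescopes, as
   [q ^- 4 * q ^ 2j = q ^ 2(j - 2)]. *)
Lemma primitive_shell_sum :
  \sum_(j < J.+2) primitive_shell j * (q ^+ 2) ^+ j
    + primitive_shell J.+2 * (q ^+ 2) ^+ J.+2 / (1 - q) = 0.
Proof.
have tele n : \sum_(j < n.+2) primitive_shell j * (q ^+ 2) ^+ j =
    (N n.+1 - N n.+2) * (q ^+ 2) ^+ n.+1 + (N n - N n.+1) * (q ^+ 2) ^+ n.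
  elim: n => [|n IH].
    rewrite !big_ord_recr big_ord0 /= /primitive_shell /=.
    by rewrite !expr0 !expr1; ring.
  rewrite big_ord_recr /= IH /primitive_shell !subSS !subn0 /=.
  by rewrite !exprS; field.
have q10 : 1 - q != 0 by rewrite subr_eq0 lt_eqF.
rewrite tele /primitive_shell !subSS !subn0 /=.
rewrite (N_rec (leqnSn _)) (N_rec (leqnn _)) !exprS; field.
by rewrite q10 q_neq0.
Qed.

End VolumeRecurrence.

Section ConstantOnPieces.
Context (R : realType) d (T : measurableType d) (mu : {measure set T -> \bar R}).
Variables (L : nat -> set T) (m c : nat -> R) (f : T -> R) (B l : R).
Hypothesis mL : forall j, measurable (L j).
Hypothesis tL : trivIset setT L.
Hypothesis muL : forall j, mu (L j) = (m j)%:E.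
Hypothesis fL : forall j t, L j t -> f t = c j.
Let V := \bigcup_j L j.
Hypothesis sum_le : forall n, \sum_(j < n) m j * `|c j| <= B.

Lemma measurable_fun_pieces : measurable_fun V f.
Proof.
move=> _ Y mY; rewrite (_ : _ `&` _ = \bigcup_(j in [set j | Y (c j)]) L j).
  by apply: bigcup_measurable => j _; exact: mL.
apply/seteqP; split => [t [[j _ Lt] Yt]|t [j Yj Lt]].
  by exists j => //=; rewrite -(fL Lt).
by split; [exists j|rewrite /= (fL Lt)].
Qed.
Let mf := measurable_fun_pieces.

Lemma integrable_pieces : mu.-integrable V (EFin \o f).
Proof.
apply/integrableP; split; first exact/measurable_EFinP.
rewrite (_ : (fun x => _) = (fun x => `|f x|%:E)); last first.
  by apply/funext.
rewrite ge0_integral_bigcup//; last first.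
  by apply/measurable_EFinP; apply: measurableT_comp mf => //; exact: normr_measurable.
apply: (le_lt_trans _ (ltry B)); apply: lime_le.
  by apply: is_cvg_nneseries => n _ _; apply: integral_ge0 => x _; rewrite lee_fin.
apply: nearW => n; rewrite big_mkord (eq_bigr (fun j : 'I_n => (m j * `|c j|)%:E)).
  by rewrite sumEFin lee_fin; exact: sum_le.
move=> j _; rewrite (eq_integral (cst (`|c j|%:E))).
  by rewrite integral_cst// muL -EFinM mulrC.
by move=> x; rewrite inE => /fL ->.
Qed.

Hypothesis sum_cvg : \sum_(j < n) m j * c j @[n --> \oo] --> l.

Lemma Rintegral_pieces : Rintegral mu V f = l.
Proof.
rewrite /Rintegral integral_bigcup//; last exact: integrable_pieces.
have -> : (fun n => \sum_(0 <= i < n) (\int[mu]_(x in L i) (f x)%:E))%E =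
    (fun n => (\sum_(j < n) m j * c j)%:E).
  apply/funext => n; rewrite big_mkord -sumEFin; apply: eq_bigr => j _.
  rewrite (eq_integral (cst (c j)%:E)).
    by rewrite integral_cst// muL -EFinM mulrC.
  by move=> x; rewrite inE => /fL ->.
suff -> : limn (fun n => (\sum_(j < n) m j * c j)%:E) = l%:E by [].
by apply/cvg_lim => //; apply/fine_cvgP; split; [exact: nearW|exact: sum_cvg].
Qed.

End ConstantOnPieces.

(** * The complex exponential and simple poles *)

Local Open Scope complex_scope.

Section ComplexExponential.
Context (R : realType).
Local Notation C := (R[i])^o.
Implicit Types (z w h : R[i]) (e d : R).

Definition cexp z : R[i] :=
  (expR (complex.Re z))%:C * (cos (complex.Im z) +i* sin (complex.Im z)).

Lemma cpowE (r : R) z : r != 0 -> cpow r z = cexp (z * (ln r)%:C).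
Proof.
by case: z => a b r0; rewrite /cpow (negbTE r0) /cexp; simpc; rewrite /= ?mulr0 ?addr0 ?subr0.
Qed.

Lemma cexp0 : cexp 0 = 1.
Proof. by rewrite /cexp /= expR0 cos0 sin0; simpc. Qed.

Lemma cexpD z w : cexp (z + w) = cexp z * cexp w.
Proof.
case: z w => a b [c d]; rewrite /cexp /=; simpc; rewrite expRD cosD sinD.
by apply/eqP; rewrite eq_complex /=; apply/andP; split; apply/eqP; ring.
Qed.

Lemma cexpX z n : cexp z ^+ n = cexp (n%:R * z).
Proof.
elim: n => [|n IH]; first by rewrite expr0 mul0r cexp0.
by rewrite exprS IH -cexpD mulrSr mulrDl mul1r addrC.
Qed.

Lemma cexp_real (a : R) : cexp a%:C = (expR a)%:C.
Proof. by rewrite /cexp /= cos0 sin0; simpc. Qed.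

Lemma complex_norm_real z : `|z| = (complex.Re `|z|)%:C.
Proof. by rewrite normc_def. Qed.

Lemma complex_norm_le (a b : R) : `|a +i* b| <= (`|a| + `|b|)%:C.
Proof.
have -> : a +i* b = a%:C + b%:C * 'i by simpc.
apply: le_trans (ler_normD _ _) _; rewrite normrM.
have -> : `|'i| = 1 :> R[i] by rewrite normc_def /= expr0n /= expr1n add0r sqrtr1.
by rewrite mulr1 !normc_def /= expr0n /= !addr0 !sqrtr_sqr -rmorphD.
Qed.

Lemma normc_ge_Im z : `|complex.Im z|%:C <= `|z|.
Proof.
by case: z => a b; rewrite normc_def lecR /= -sqrtr_sqr ler_wsqrtr// lerDr sqr_ge0.
Qed.

Lemma is_derive_littleo (f : R -> R) (l : R) : is_derive (0 : R) 1 f l ->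
  forall e, 0 < e -> exists2 d, 0 < d &
    forall h : R, `|h| < d -> `|f h - f 0 - l * h| <= e * `|h|.
Proof.
move=> [df dl] e e0.
have : (fun h : R => h^-1 *: ((f \o shift 0) (h *: (1 : R)) - f 0)) @ 0^' --> l.
  by rewrite -dl; exact: df.
move=> /cvgrPdist_le/(_ e e0).
rewrite /dnbhs /within /= => /nbhs_ballP[d /= d0 dP].
exists d => // h hd; have [->|h0] := eqVneq h 0.
  by rewrite subrr mulr0 subr0 normr0 mulr0.
have := dP h; rewrite /ball/= sub0r normrN => /(_ hd h0).
rewrite /= addr0 /GRing.scale /= mulr1 distrC => H.
have -> : f h - f 0 - l * h = (h^-1 * (f h - f 0) - l) * h.
  by rewrite mulrBl mulrAC mulVf// mul1r.
by rewrite normrM ler_wpM2r.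
Qed.

(** Obtained from the real first-order expansions of [expR], [sin] and [cos]; with the addition law
    this is all the complex analysis of [cexp] that is used. *)
Lemma cexp_littleo e : 0 < e -> exists2 d, 0 < d &
  forall h, `|h| < d%:C -> `|cexp h - 1 - h| <= e%:C * `|h|.
Proof.
(* The errors collected below add up to at most [6 * e' * |h|], whence the margin [e / 8]. The cap
   at [1], with [|a| < e' / 2] from [d], gives [|expR a| <= 2], [|1 + a| <= 2] and
   [|expR a - 1| <= e']. *)
move=> e0; pose e' := Num.min (e / 8) 1.
have e'0 : 0 < e' by rewrite lt_min ltr01 andbT divr_gt0.
have e'e : e' <= e / 8 by rewrite /e' ge_min lexx.
have e'1 : e' <= 1 by rewrite /e' ge_min lexx orbT.
have [d1 d10 H1] := is_derive_littleo (is_derive_expR 0) e'0.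
have [d2 d20 H2] := is_derive_littleo (is_derive_sin 0) e'0.
have [d3 d30 H3] := is_derive_littleo (is_derive_cos 0) e'0.
pose d := Num.min (Num.min d1 d2) (Num.min d3 (e' / 2)).
exists d; first by rewrite !lt_min d10 d20 d30 divr_gt0.
move=> [a b] hd.
have an : `|a|%:C <= `|a +i* b| := normc_ge_Re (a +i* b).
have bn : `|b|%:C <= `|a +i* b| := normc_ge_Im (a +i* b).
have ad : `|a| < d by rewrite -ltcR; exact: le_lt_trans hd.
have bd : `|b| < d by rewrite -ltcR; exact: le_lt_trans hd.
move: ad bd; rewrite !lt_min => /andP[/andP[a1 a2] /andP[a3 a4]].
move=> /andP[/andP[b1 b2] /andP[b3 b4]].
have h1 := H1 a a1; rewrite expR0 mul1r in h1.
have h2 := H2 b b2; rewrite sin0 cos0 mul1r subr0 in h2.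
have h3 := H3 b b3; rewrite cos0 sin0 oppr0 mul0r subr0 in h3.
move: h1 h2 h3; set ea := expR a; set sb := sin b; set cb := cos b => h1 h2 h3.
have cb1 : `|cb| <= 1 by rewrite ler_norml cos_geN1 cos_le1.
have ea1 : `|ea - 1| <= 2 * `|a|.
  rewrite -[ea - 1](subrK a); apply: le_trans (ler_normD _ _) _.
  have : e' * `|a| <= `|a| by rewrite ler_piMl.
  by move: h1; lra.
have ea2 : `|ea| <= 2.
  rewrite -[ea](subrK 1); apply: le_trans (ler_normD _ _) _; rewrite normr1.
  by move: ea1 a4; lra.
have a0 := normr_ge0 a; have b0 := normr_ge0 b.
have E1 : `|ea * cb - 1 - a| <= e' * `|a| + 2 * (e' * `|b|).
  have -> : ea * cb - 1 - a = (ea - 1 - a) * cb + (1 + a) * (cb - 1) by ring.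
  apply: le_trans (ler_normD _ _) _; rewrite !normrM; apply: lerD.
    by rewrite -[leRHS]mulr1; apply: ler_pM.
  apply: ler_pM => //; apply: le_trans (ler_normD _ _) _; rewrite normr1.
  by move: a4; lra.
have E2 : `|ea * sb - b| <= 2 * (e' * `|b|) + e' * `|b|.
  have -> : ea * sb - b = ea * (sb - b) + (ea - 1) * b by ring.
  apply: le_trans (ler_normD _ _) _; rewrite !normrM; apply: lerD.
    by apply: ler_pM.
  apply: ler_pM => //; by move: ea1 a4; lra.
have -> : cexp (a +i* b) - 1 - (a +i* b) = (ea * cb - 1 - a) +i* (ea * sb - b).
  by rewrite /cexp /= -/ea -/sb -/cb; simpc; rewrite /= ?mul0r ?subr0 ?addr0.
apply: le_trans (complex_norm_le _ _) _.
rewrite [`|a +i* b|]complex_norm_real -rmorphM lecR.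
move: an bn; rewrite [`|a +i* b|]complex_norm_real !lecR.
set n := complex.Re _ => an bn.
apply: le_trans (lerD E1 E2) _.
have e'a : e' * `|a| <= e / 8 * n by apply: ler_pM => //; exact: ltW.
have e'b : e' * `|b| <= e / 8 * n by apply: ler_pM => //; exact: ltW.
have n0 : 0 <= n by exact: le_trans an.
have en : 0 <= e * n by rewrite mulr_ge0// ltW.
move: e'a e'b; set u := e' * _; set w := e' * _; rewrite mulrAC.
by move=> *; lra.
Qed.

(** In [R[i]] a positive element has zero imaginary part, so real tolerances and radii suffice. *)
Lemma complex_cvg_dnbhs (phi : R[i] -> R[i]) (l : R[i]) :
  (forall e, 0 < e -> exists2 d, 0 < d &
     forall h, h != 0 -> `|h| < d%:C -> `|phi h - l| <= e%:C) ->
  (phi : C -> C) h @[h --> (0 : C)^'] --> (l : C).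
Proof.
move=> H; apply/cvgrPdist_le => -[e1 e2]; rewrite ltcE /= => /andP[/eqP -> e0].
have [d d0 dP] := H e1 e0.
rewrite /dnbhs /within /=; apply/nbhs_ballP; exists d%:C; first by rewrite /= ltcR.
move=> h; rewrite /ball /= sub0r normrN => hd h0.
by rewrite distrC; exact: dP.
Qed.

Lemma cexp_quotient_cvg (a : R[i]) :
  ((fun h : C => h^-1 * (cexp (a * h) - 1)) : C -> C) h @[h --> (0 : C)^'] --> (a : C).
Proof.
apply: complex_cvg_dnbhs => e e0.
pose A := complex.Re `|a|; have aA : `|a| = A%:C := complex_norm_real a.
have A0 : 0 <= A by rewrite -ler0c -aA.
have A1 : 0 < A + 1 by lra.
have [d d0 dP] := cexp_littleo (divr_gt0 e0 A1).
exists (d / (A + 1)); first exact: divr_gt0.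
move=> h h0; rewrite [`|h|]complex_norm_real ltcR ltr_pdivlMr// => hd.
have nh : 0 <= complex.Re `|h| by rewrite -ler0c -complex_norm_real.
have := dP (a * h); rewrite normrM aA [`|h|]complex_norm_real -rmorphM ltcR.
have lt1 : A * complex.Re `|h| < d.
  by apply: le_lt_trans hd; rewrite mulrC ler_wpM2l// lerDl.
move=> /(_ lt1); rewrite -rmorphM => H.
have -> : h^-1 * (cexp (a * h) - 1) - a = h^-1 * (cexp (a * h) - 1 - a * h).
  by rewrite [in RHS]mulrBr [a * h]mulrC mulKf.
rewrite normrM normfV mulrC ler_pdivrMr ?normr_gt0//.
apply: le_trans H _; rewrite [`|h|]complex_norm_real -rmorphM lecR mulrA ler_wpM2r//.
by rewrite mulrAC ler_pdivrMr// ler_wpM2l ?(ltW e0)//; lra.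
Qed.

Lemma derivable_cexp (a z : C) : derivable (fun s : C => cexp (a * s) : C) z 1.
Proof.
apply/cvg_ex; exists (cexp (a * z) * a : C).
have : (fun h : C => cexp (a * z) * (h^-1 * (cexp (a * h) - 1)) : C) h
    @[h --> (0 : C)^'] --> (cexp (a * z) * a : C).
  by apply: cvgM; [exact: cvg_cst|exact: cexp_quotient_cvg].
apply: cvg_trans; apply: near_eq_cvg; apply: nearW => h /=.
rewrite /GRing.scale /= mulr1 (mulrDr a) cexpD.
by rewrite mulrCA; congr (_ * _); rewrite mulrBr mulr1 mulrC.
Qed.

Lemma derivable_complex_continuous (f : C -> C) (z : C) :
  derivable f z 1 -> {for z, continuous f}.
Proof. by move=> /derivable1_diffP/differentiable_continuous. Qed.

Lemma near_dnbhs_shift (P : C -> Prop) (z : C) :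
  (\forall h \near (0 : C)^', P h) -> \forall w \near z, w != z -> P (w - z).
Proof.
rewrite /dnbhs {1}/prop_near1 /within /= => /nbhs_ballP[d d0 dP].
apply/nbhs_ballP; exists d => // w; rewrite /ball /= => wd wz.
by apply: dP; rewrite /ball /= ?sub0r ?opprB// subr_eq0.
Qed.

Lemma cvg_dnbhs_shift (f : C -> C) (z : C) : {for z, continuous f} ->
  (fun h : C => f (h + z) : C) h @[h --> (0 : C)^'] --> (f z : C).
Proof.
move=> fc A /fc /nbhs_ballP[d d0 dP].
rewrite /nbhs /= /dnbhs /within /=; apply/nbhs_ballP; exists d => // h hd _.
by apply: dP; move: hd; rewrite /ball /= sub0r opprD addrCA subrr addr0.
Qed.

Section SimplePoles.
Variables (f1 f2 : C -> C) (a b : C).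
Hypothesis df1 : forall z, derivable f1 z 1.
Hypothesis df2 : forall z, derivable f2 z 1.
Hypothesis a0 : a != 0.

(** Used with [a = - 2 ln q] and [b = q], where it equals [1 - q ^ (1 - 2 s)], the denominator of
    the geometric tail. *)
Definition pole_factor (s : C) : C := 1 - b * cexp (a * s).

Definition pole_fun (s : C) : C := f1 s + f2 s * (pole_factor s)^-1.

Lemma derivable_pole_factor (z : C) : derivable pole_factor z 1.
Proof.
apply: derivableB; first exact: derivable_cst.
by apply: derivableM; [exact: derivable_cst|exact: derivable_cexp].
Qed.

Lemma derivable_pole_fun (z : C) : pole_factor z != 0 -> derivable pole_fun z 1.
Proof.
move=> z0; apply: derivableD; first exact: df1.
by apply: derivableM; [exact: df2|apply: derivableV => //; exact: derivable_pole_factor].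
Qed.

Lemma holomorphic_pole_fun (z : C) : pole_factor z != 0 -> holomorphic_at pole_fun z.
Proof.
move=> z0; have cD := derivable_complex_continuous (derivable_pole_factor (z := z)).
have : \forall w \near z, pole_factor w != 0.
  apply: (cD [set x | x != 0]); apply/nbhs_ballP; exists `|pole_factor z|.
    by rewrite /= normr_gt0.
  by move=> y; rewrite /ball /=; apply: contraTneq => ->; rewrite subr0 ltxx.
by apply: filterS => w; exact: derivable_pole_fun.
Qed.

Lemma pole_factor_shift (z h : C) : pole_factor z = 0 ->
  pole_factor (h + z) = - (cexp (a * h) - 1).
Proof.
move=> /eqP; rewrite /pole_factor subr_eq0 => /eqP e.
by rewrite mulrDr cexpD mulrCA -e mulr1 opprB.
Qed.

(* Near a zero of [pole_factor], which is simple, multiplication by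
   [(s - z) ^ 2] rather than [s - z] makes the first-order expansion of the
   exponential sufficient for the derivative at [z] itself. *)
Lemma meromorphic_pole_fun (z : C) : meromorphic_at pole_fun z.
Proof.
have [z0|z0] := eqVneq (pole_factor z) 0; last first.
  exists 0%N, pole_fun; split; first exact: holomorphic_pole_fun.
  by apply: nearW => w; rewrite expr0 mul1r.
exists 2%N, (fun s : C => (s - z) * (s - z) * pole_fun s : C); split; last first.
  by apply: nearW => w; rewrite expr2.
have qc := cexp_quotient_cvg (a := a).
have nz : \forall h \near (0 : C)^', cexp (a * h) - 1 != 0.
  have : \forall h \near (0 : C)^', h^-1 * (cexp (a * h) - 1) != 0.
    apply: (qc [set x | x != 0]); apply/nbhs_ballP; exists `|a|.
      by rewrite /= normr_gt0.
    by move=> y; rewrite /ball /=; apply: contraTneq => ->; rewrite subr0 ltxx.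
  by apply: filterS => h; apply: contra_neq => ->; rewrite mulr0.
have dshift w : derivable (fun s : C => s - z) w 1.
  by apply: derivableB; [exact: derivable_id|exact: derivable_cst].
have := near_dnbhs_shift z nz; apply: filterS => w wP.
have [->|wz] := eqVneq w z; last first.
  apply: derivableM; first exact: (derivableM (dshift w) (dshift w)).
  apply: derivable_pole_fun.
  by rewrite -(subrK z w) pole_factor_shift// oppr_eq0; exact: wP.
have df1z : derivable f1 z 1 by exact: df1.
have f1c := cvg_dnbhs_shift (derivable_complex_continuous df1z).
have df2z : derivable f2 z 1 by exact: df2.
have f2c := cvg_dnbhs_shift (derivable_complex_continuous df2z).
have idc : h @[h --> (0 : C)^'] --> (0 : C) by exact: cvg_within.
(* The function vanishes at [z], so its difference quotient is [h * pole_fun (h + z)]; the factor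
   [h] compensates the simple zero of [pole_factor], whose slope at [z] is [- a]. *)
apply/cvg_ex; exists (0 * f1 z + f2 z * - a^-1).
have : (fun h : C => h * f1 (h + z) + f2 (h + z) * - (h^-1 * (cexp (a * h) - 1))^-1 : C) h
    @[h --> (0 : C)^'] --> (0 * f1 z + f2 z * - a^-1 : C).
  have t1 : (fun h : C => h * f1 (h + z) : C) h @[h --> (0 : C)^'] --> (0 * f1 z : C).
    by apply: cvgM; [exact: idc|exact: f1c].
  have t2 : (fun h : C => (h^-1 * (cexp (a * h) - 1))^-1 : C) h @[h --> (0 : C)^'] -->
      (a^-1 : C).
    by apply: cvgV; [exact: a0|exact: qc].
  have t3 : (fun h : C => - (h^-1 * (cexp (a * h) - 1))^-1 : C) h @[h --> (0 : C)^'] -->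
      (- a^-1 : C).
    by apply: cvgN; exact: t2.
  have t4 : (fun h : C => f2 (h + z) * - (h^-1 * (cexp (a * h) - 1))^-1 : C) h
      @[h --> (0 : C)^'] --> (f2 z * - a^-1 : C).
    by apply: cvgM; [exact: f2c|exact: t3].
  by apply: cvgD; [exact: t1|exact: t4].
apply: cvg_trans; apply: near_eq_cvg.
have : \forall h \near (0 : C)^', h != 0 by exact: nbhs_dnbhs_neq.
apply: filterS => h h0 /=.
rewrite subrr !mul0r subr0 /GRing.scale /= mulr1 addrK /pole_fun.
rewrite pole_factor_shift// invrN invfM invrK -mulrA mulKf// mulrDr.
by congr (_ + _); rewrite !mulrN mulrCA.
Qed.

End SimplePoles.

End ComplexExponential.

(** * Power series with geometric coefficients *)

Section GeometricTail.

Lemma sum_geometric_tail (K : fieldType) (m : nat -> K) (w q : K) J n :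
  (forall k, m (J + k)%N = m J * q ^- k) -> 1 - w / q != 0 ->
  \sum_(j < J + n) m j * w ^+ j = \sum_(j < J) m j * w ^+ j
    + m J * w ^+ J * (1 - w / q)^-1 * (1 - (w / q) ^+ n).
Proof.
move=> mJ u1; elim: n => [|n IH]; first by rewrite addn0 expr0 subrr mulr0 addr0.
rewrite addnS big_ord_recr /= IH mJ -addrA; congr (_ + _).
rewrite exprD -exprVn.
have -> : m J * q^-1 ^+ n * (w ^+ J * w ^+ n) = m J * w ^+ J * (w / q) ^+ n.
  by rewrite exprMn; ring.
by set u := w / q in u1 *; rewrite exprS; field.
Qed.

Context (R : realType).
Variables (m : nat -> R) (J : nat) (q : R) (k0 om : R[i]).
Hypothesis m_ge0 : forall j, 0 <= m j.
Hypothesis q0 : 0 < q.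
Hypothesis mJ : forall k, m (J + k)%N = m J * q ^- k.
Hypothesis om_lt : expR (complex.Re om) < q.

Let w := cexp om.
Let rho := expR (complex.Re om).

Lemma norm_cexp (z : R[i]) : `|cexp z| = (expR (complex.Re z))%:C.
Proof.
case: z => a b; rewrite /cexp normrM !normc_def /= expr0n /= addr0 sqrtr_sqr.
by rewrite cos2Dsin2 sqrtr1 mulr1 ger0_norm ?expR_ge0.
Qed.

Let rho_lt1 : rho / q < 1.
Proof. by rewrite ltr_pdivrMr// mul1r. Qed.

Let rho_ge0 : 0 <= rho / q.
Proof. by rewrite divr_ge0 ?expR_ge0 ?ltW. Qed.

Let norm_ratio : `|w / q%:C| = (rho / q)%:C.
Proof.
rewrite normrM normfV norm_cexp normc_def /= expr0n /= addr0 sqrtr_sqr ger0_norm ?ltW//.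
by rewrite -fmorphV -rmorphM.
Qed.

Lemma ratio_neq1 : 1 - w / q%:C != 0.
Proof.
rewrite subr_eq0; apply/eqP => e; move: norm_ratio; rewrite -e normr1 => -[e1].
by move: rho_lt1; rewrite -e1 ltxx.
Qed.

(** Closed form of the series of all [k0 * m j * w ^ j]: from [J] on it is geometric with ratio
    [w / q]. *)
Definition power_series_value : R[i] := k0 * (\sum_(j < J) (m j)%:C * w ^+ j
  + (m J)%:C * w ^+ J * (1 - w / q%:C)^-1).

Lemma power_series_bound (c : nat -> R) :
  (forall j, `|c j|%:C <= `|k0 * w ^+ j|) ->
  exists B, forall n, \sum_(j < n) m j * `|c j| <= B.
Proof.
move=> cw; pose k := complex.Re `|k0|; have kE : `|k0| = k%:C := complex_norm_real k0.
have k_ge0 : 0 <= k by rewrite -ler0c -kE.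
have c_le j : `|c j| <= k * rho ^+ j.
  by move: (cw j); rewrite normrM normrX norm_cexp kE -rmorphXn -rmorphM lecR.
exists (k * (\sum_(j < J) m j * rho ^+ j + m J * rho ^+ J * (1 - rho / q)^-1)) => n.
have t0 j : 0 <= m j * rho ^+ j by rewrite mulr_ge0// exprn_ge0// expR_ge0.
apply: (@le_trans _ _ (k * \sum_(j < J + n) m j * rho ^+ j)).
  rewrite mulr_sumr addnC big_split_ord /=; apply: ler_wpDr.
    by apply: sumr_ge0 => j _; rewrite mulr_ge0.
  by apply: ler_sum => j _; rewrite mulrCA ler_wpM2l.
apply: ler_wpM2l => //; rewrite (sum_geometric_tail (q := q))//; last first.
  by rewrite gt_eqF// subr_gt0.
rewrite lerD2l ler_piMr//.
  by rewrite mulr_ge0 ?invr_ge0 ?subr_ge0 ?(ltW rho_lt1).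
by rewrite gerBl exprn_ge0.
Qed.

(** Stated for a real-linear [p] bounded by the norm, so that one proof serves both the real and the
    imaginary part. The remainder is squeezed by a geometric sequence of ratio [rho / q < 1]. *)
Lemma power_series_cvg (p : R[i] -> R) : {morph p : x y / x + y} ->
  (forall (a : R) x, p (a%:C * x) = a * p x) -> (forall x, `|p x|%:C <= `|x|) ->
  \sum_(j < n) m j * p (k0 * w ^+ j) @[n --> \oo] --> p power_series_value.
Proof.
move=> pD pZ p_le.
have p0 : p 0 = 0 by have := pZ 0 0; rewrite mulr0 mul0r.
have pS n : \sum_(j < n) m j * p (k0 * w ^+ j) =
    p (k0 * \sum_(j < n) (m j)%:C * w ^+ j).
  elim: n => [|n IH]; first by rewrite !big_ord0 mulr0 p0.
  by rewrite !big_ord_recr /= IH mulrDr pD mulrCA pZ.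
pose b := k0 * ((m J)%:C * w ^+ J * (1 - w / q%:C)^-1).
pose B := complex.Re `|b|; have bE : `|b| = B%:C := complex_norm_real b.
have mJc k : (m (J + k)%N)%:C = (m J)%:C * q%:C ^- k.
  by rewrite mJ rmorphM fmorphV rmorphXn.
rewrite -(cvg_shiftn J).
rewrite (_ : (fun n => _) =
    (fun n => p power_series_value + p (- (b * (w / q%:C) ^+ n)))); last first.
  apply/funext => n /=; rewrite addnC pS -pD; congr p.
  rewrite (sum_geometric_tail (m := fun j => (m j)%:C) n mJc ratio_neq1).
  by rewrite /power_series_value /b; ring.
have geo : B * (rho / q) ^+ n @[n --> \oo] --> 0.
  by apply: cvg_geometric; rewrite ger0_norm.
have ngeo : - (B * (rho / q) ^+ n) @[n --> \oo] --> - 0 by exact: cvgN.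
rewrite oppr0 in ngeo.
have tail : p (- (b * (w / q%:C) ^+ n)) @[n --> \oo] --> 0.
  apply: (squeeze_cvgr _ ngeo geo); apply: nearW => n.
  rewrite -ler_norml -lecR; apply: le_trans (p_le _) _.
  by rewrite normrN normrM normrX norm_ratio bE -rmorphXn -rmorphM.
have := cvgD (cvg_cst (p power_series_value)) tail; rewrite addr0; exact.
Qed.

End GeometricTail.

(** * The coordinates of [D] and the coefficients of the form *)

Section Descent.
Context (F : fieldType) (E : fieldExtType F).
Variables (A : F) (rootA : E) (sigma : 'AEnd(E)) (D : E).
Hypothesis two_neq0 : (2 : F) != 0.
Hypothesis hA0 : A != 0.
Hypothesis hA : ~ exists a : F, A = a ^+ 2.
Hypothesis rootA_sqr : rootA ^+ 2 = A%:A.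
Hypothesis rootA_gen : <<1; rootA>>%VS = {:E}%VS.
Hypothesis sigma_neq1 : sigma != \1%AF.

Lemma descend_scale (c : F) : descend (c%:A : E) = c.
Proof.
rewrite /descend; case: xgetP => [a _ /= h|/(_ c)/=]; last by [].
by apply: (fmorph_inj (in_alg E)); exact: h.
Qed.

(** Since [sigma] negates [rootA], the two descended coefficients are [b] and [2 * a]. *)
Lemma quad_form_binary : exists a b : F, D = a%:A + b *: rootA /\
  forall x y z t, quad_form A rootA sigma D x y z t =
    2 * z * t - binary A b (2 * a) x y.
Proof.
have [a [b Dab]] := rootA_decomp rootA_sqr rootA_gen D; exists a, b; split=> // x y z t.
have sD : sigma D = a%:A - b *: rootA.
  by rewrite Dab linearD !linearZ /= rmorph1 (sigma_rootA rootA_sqr rootA_gen sigma_neq1).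
have r0 : rootA != 0.
  apply: contraNneq hA0 => r0; move: rootA_sqr; rewrite r0 expr0n /= => /esym/eqP.
  by rewrite scaler_eq0 oner_eq0 orbF.
have two0 : (2 : E) != 0 by rewrite -(rmorph_nat (in_alg E)) fmorph_eq0.
have e1 : (D - sigma D) / (2 * rootA) = b%:A.
  rewrite sD Dab -!(mulr_algl b rootA); move: (a%:A) (b%:A) => a' b'.
  have -> : a' + b' * rootA - (a' - b' * rootA) = b' * (2 * rootA) by ring.
  by rewrite mulfK// mulf_neq0.
have e2 : D + sigma D = (2 * a)%:A.
  by rewrite sD Dab addrACA subrr addr0 -scalerDl mulr2n mulrDl mul1r.
by rewrite /quad_form e1 e2 !descend_scale /binary; ring.
Qed.

(* [binary x y] is the coefficient of [rootA] in [D * (y + x rootA) ^ 2]. *)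
Lemma binary_anisotropic (a b : F) : D = a%:A + b *: rootA -> D != 0 ->
  ~ (exists (c : F) (e : E), [/\ c != 0, e != 0 & D = c *: e ^+ 2]) ->
  forall x y, binary A b (2 * a) x y = 0 -> x = 0 /\ y = 0.
Proof.
move=> Dab D0 hD x y xy.
pose e : E := y%:A + x *: rootA.
have De : D * e ^+ 2 = (a * (y ^+ 2 + A * x ^+ 2) + 2 * b * A * x * y)%:A
    + binary A b (2 * a) x y *: rootA.
  rewrite Dab /e /binary -!(mulr_algl _ rootA) -!in_algE.
  rewrite !(rmorphD, rmorphM, rmorphXn, rmorph_nat) /=.
  rewrite scale1r; move: rootA_sqr.
  move: (a%:A) (b%:A) (A%:A) (x%:A) (y%:A) rootA => a' b' A' x' y' r rA.
  (* Adding this vanishing multiple of [r ^ 2 - A'] makes the claim a polynomial identity; the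
     cofactor collects the terms of the expansion that contain [r ^ 2] or [r ^ 3]. *)
  have z : (r ^+ 2 - A') * (a' * x' ^+ 2 + 2 * b' * x' * y' + b' * x' ^+ 2 * r) = 0.
    by rewrite rA subrr mul0r.
  by rewrite -[RHS]addr0 -z; ring.
have e0 : e = 0.
  apply/eqP/negPn/negP => e0; apply: hD.
  move: De; rewrite xy scale0r addr0; set c := (X in X%:A) => De.
  have De0 : D * e ^+ 2 != 0 by rewrite mulf_neq0// expf_neq0.
  exists c, e^-1; split; rewrite ?invr_eq0//.
    by apply: contraNneq De0 => c0; rewrite De c0 scale0r.
  by rewrite -mulr_algl -De exprVn mulfK// expf_neq0.
have x0 : x = 0.
  apply/eqP/negPn/negP => x0; apply: hA; exists (- y / x).
  have rE : rootA = (- y / x)%:A.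
    apply: (scalerI x0); rewrite scalerA mulrCA divff// mulr1.
    by apply/eqP; rewrite scaleNr eq_sym eqr_oppLR -addr_eq0 -/e e0.
  apply: (fmorph_inj (in_alg E)); rewrite /= -rootA_sqr rE -!in_algE.
  by rewrite rmorphXn.
split=> //; apply: (fmorph_inj (in_alg E)); rewrite /= scale0r.
by move: e0; rewrite /e x0 scale0r addr0.
Qed.

End Descent.

(** * The integral as a power series *)

Section LevelIntegral.
Context (R : realType) (F : nonarchLocalFieldType R).
Variable mu : {sigma_finite_measure set (borel F) -> \bar R}.
Hypothesis hmu : normalized_haar mu.

Local Notation q := ((@residue_card R F)%:R : R).
Local Notation qi := ((@residue_card R F)%:R^-1 : R).
Local Notation pi := (@uniformizer R F).
Local Notation qi0 := (@residue_card_inv_gt0 R F).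
Local Notation qi1 := (@residue_card_inv_lt1 R F).
Local Notation V := (@primitive_vectors R F).

Variables (p : F -> F -> F) (C K : nat).
Hypothesis mp : measurable_fun setT (fun u : borel F * borel F => p u.1 u.2 : borel F).
Hypothesis two1 : labs (2 : F) = 1 :> R.
Hypothesis p_hom : forall a x y : F, p (x * a) (y * a) = p x y * a ^+ 2.
Hypothesis p_le : forall x y, labs x <= 1 :> R -> labs y <= 1 :> R ->
  labs (p x y) <= (qi ^+ C)^-1.
Hypothesis p_gt : forall x y, labs x <= 1 :> R -> labs y <= 1 :> R ->
  labs x = 1 :> R \/ labs y = 1 :> R -> qi ^+ K < labs (p x y).

Lemma residue_card_real_gt1 : 1 < q.
Proof. by rewrite ltr1n residue_card_gt1. Qed.
Local Notation q1 := residue_card_real_gt1.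

Lemma labs_exprP (x : F) : x != 0 -> labs x <= 1 :> R -> exists n, labs x = qi ^+ n.
Proof.
move=> x0 x1; have h : exists n, qi ^+ n < labs x.
  by apply: residue_expr_small; rewrite labs_gt0.
case: (ex_minnP h) => -[|n]; first by rewrite expr0 ltNge x1.
move=> nx nmin; exists n; apply/eqP; rewrite eq_le.
have -> : labs x <= qi ^+ n by rewrite leNgt; apply/negP => /nmin; rewrite ltnn.
by rewrite leNgt labs_lt_expr -ltNge.
Qed.

(** Level [0] is the bound [q ^ C] for [|Q|] on integral vectors, so natural indices reach every
    nonzero value. *)
Definition radius (j : nat) : R := qi ^+ j / qi ^+ C.

Lemma radius_gt0 j : 0 < radius j.
Proof. by rewrite divr_gt0 ?exprn_gt0 ?qi0. Qed.

Lemma le_radius (x : F) j : (labs x <= radius j) = (labs (x * pi ^+ C) <= qi ^+ j).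
Proof. by rewrite ler_pdivlMr ?exprn_gt0 ?qi0// labsM labs_uniformizerX. Qed.

Lemma quat_le v : integral4 v -> labs (quat p v : F) <= radius 0.
Proof.
case: v => [[[x y] z] t] [[[/= x1 y1] z1] t1]; apply: labsB_le; last first.
  by rewrite /radius expr0 div1r; exact: p_le.
have -> : radius 0 = (qi ^+ C)^-1 by rewrite /radius expr0 div1r.
apply: (@le_trans _ _ 1).
  by rewrite !labsM two1 mul1r mulr_ile1 ?labs_ge0.
by rewrite invf_ge1 ?exprn_gt0 ?qi0// exprn_ile1 ?(ltW qi0) ?(ltW qi1).
Qed.

Lemma quat_ball_large r : radius 0 <= r -> quat_ball p r = @integral4 R F.
Proof. by move=> r0; apply: setIidl => v /quat_le /le_trans; apply. Qed.

Definition volume (j : nat) : R := quat_volume mu p (radius j).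

(** For [j < 2] both radii are at least [radius 0], so both balls are the whole of [integral4] and
    the truncated index is correct. *)
Lemma volume_div j : quat_volume mu p (radius j / qi ^+ 2) = volume (j - 2).
Proof.
have q2 : 0 < qi ^+ 2 by rewrite exprn_gt0 ?qi0.
have [j2|j2] := leqP 2 j.
  rewrite /volume /radius; congr quat_volume.
  by rewrite mulrAC -{1}(subnK j2) exprD mulfK// gt_eqF.
have -> : (j - 2 = 0)%N by apply/eqP; rewrite subn_eq0 ltnW.
rewrite /volume /quat_volume !quat_ball_large//.
rewrite ler_pdivlMr// /radius mulrAC ler_pM2r ?invr_gt0 ?exprn_gt0 ?qi0//.
by rewrite expr0 mul1r ler_wiXn2l ?(ltW qi0) ?(ltW qi1)// ltnW.
Qed.

(** The threshold has two parts: beyond [C] the radius is some [q ^ -k] and the slicing formula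
    applies; a further [K] makes the area recurrence valid. The claim is then an identity in one
    partial sum and two areas. *)
Lemma volume_rec j : (C + K <= j)%N ->
  volume j.+2 = q ^- 3 * volume j + (q^-1 - q ^- 2) * volume j.+1.
Proof.
move=> CKj; pose k := (j - C)%N.
have kj : j = (C + k)%N by rewrite subnKC// (leq_trans (leq_addr _ _) CKj).
have Kk : (K <= k)%N by rewrite -(leq_add2l C) -kj.
have volE l : volume (C + l) = qi ^+ l * ((1 - qi) * \sum_(i < l.+1) binary_volume mu p i
    + qi * binary_volume mu p l).
  apply: EFin_inj; rewrite -(measure_quat_ball hmu mp two1) -(quat_volumeE hmu mp).
  congr (haar4 mu _); congr quat_ball.
  by rewrite /radius addnC exprD mulfK// expf_neq0// gt_eqF ?qi0.
rewrite kj -!addnS !volE !big_ord_recr /= (binary_volume_rec hmu mp p_hom Kk p_gt).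
have q0 : q != 0 by rewrite gt_eqF// (lt_trans _ q1).
by rewrite -!exprVn !exprS; move: (qi ^+ k) (qi) => u v; ring.
Qed.

Definition level (j : nat) : set (borel F * borel F * borel F * borel F) :=
  V `&` [set v | labs (quat p v : F) = radius j].

Lemma measurable_level j : measurable (level j).
Proof.
apply: measurableI; [exact: measurable_primitive_vectors|apply: measurable_labs_eq].
exact: measurable_fun_quat.
Qed.

Lemma measure_level j : haar4 mu (level j) = (primitive_shell q volume j)%:E.
Proof.
have levelE : primitive_ball p (radius j) = level j `|` primitive_ball p (radius j.+1).
  rewrite /primitive_ball /level -setIUr; congr (_ `&` _); apply/seteqP; split => v /=.
    rewrite !le_radius -labs_lt_expr le_eqVlt => /orP[/eqP e|]; last by right.
    left; apply: (mulIf (x := qi ^+ C)); first by rewrite expf_neq0// gt_eqF ?qi0.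
    by rewrite /radius divfK ?expf_neq0 ?gt_eqF ?qi0// -e labsM labs_uniformizerX.
  move=> [->|]; first by rewrite lexx.
  by rewrite !le_radius -labs_lt_expr => /ltW.
have dis : level j `&` primitive_ball p (radius j.+1) = set0.
  rewrite -subset0 => v [[_ /= vj] [_ /=]].
  rewrite le_radius -labs_lt_expr labsM vj labs_uniformizerX divfK ?ltxx//.
  by rewrite expf_neq0// gt_eqF ?qi0.
have e : haar4 mu (primitive_ball p (radius j)) =
    (haar4 mu (level j) + haar4 mu (primitive_ball p (radius j.+1)))%E.
  rewrite levelE; apply: measureU => //; first exact: measurable_level.
  exact: measurable_primitive_ball.
move: e; rewrite !(measure_primitive_ball hmu mp p_hom) !volume_div.
move=> /(congr1 (fun u => u - (volume j.+1 - qi ^+ 4 * volume (j.+1 - 2))%:E)%E).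
by rewrite addeK// -EFinB /primitive_shell -!exprVn => <-.
Qed.

Lemma primitive_shell_ge0 j : 0 <= primitive_shell q volume j.
Proof. by rewrite -lee_fin -measure_level. Qed.

(** The zero locus of [Q] takes index [0] to complete the partition. Its mass is never computed:
    [cpow] is [0] there by convention. *)
Definition piece (j : nat) : set (borel F * borel F * borel F * borel F) :=
  if j is j'.+1 then level j' else V `&` [set v | labs (quat p v : F) = 0 :> R].

Lemma measurable_piece j : measurable (piece j).
Proof.
case: j => [|j]; last exact: measurable_level.
apply: measurableI; [exact: measurable_primitive_vectors|apply: measurable_labs_eq].
exact: measurable_fun_quat.
Qed.

Lemma trivIset_piece : trivIset setT piece.
Proof.
have r0 j : radius j != 0 by rewrite gt_eqF ?radius_gt0.
move=> [|i] [|j] _ _ //= [v [[_ /= vi] [_ /= vj]]].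
- by move: (r0 j); rewrite -vj vi eqxx.
- by move: (r0 i); rewrite -vi vj eqxx.
- congr S; apply/eqP.
  have rij : qi ^+ i = qi ^+ j.
    apply: (mulIf (x := (qi ^+ C)^-1)); last by rewrite -/(radius i) -vi vj.
    by rewrite invr_eq0 expf_neq0// gt_eqF ?qi0.
  by apply/eqP/(ieexprIn qi0 _ rij); rewrite lt_eqF ?qi1.
Qed.

Lemma primitive_vectors_pieces : V = \bigcup_j piece j.
Proof.
apply/seteqP; split => [v vV|v [[|j] _ []]//].
have [Q0|Q0] := eqVneq (quat p v : F) 0.
  by exists 0%N => //; split => //=; rewrite Q0 labs0.
have v4 : integral4 v by move: vV; rewrite primitive_vectorsE => -[].
have := quat_le v4; rewrite le_radius expr0 => h.
have Qp : (quat p v : F) * pi ^+ C != 0.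
  by rewrite mulf_neq0// expf_neq0// uniformizer_neq0.
have [n nE] := labs_exprP Qp h; exists n.+1 => //; split => //=.
by rewrite /radius -nE labsM labs_uniformizerX mulfK// expf_neq0// gt_eqF ?qi0.
Qed.

Let lq := ln q.

Lemma radiusE j : radius j = expR ((C%:R - j%:R) * lq).
Proof.
have q0 : 0 < q by rewrite (lt_trans _ q1).
have qE : expR lq = q by rewrite /lq lnK// posrE.
by rewrite mulrBl expRD expRN !expRM_natl qE /radius !exprVn invrK mulrC.
Qed.

Lemma cpow_radius (la : R[i]) j :
  cpow (radius j) la = cexp (la * (C%:R * lq)%:C) * cexp (la * (- lq)%:C) ^+ j.
Proof.
rewrite cpowE ?gt_eqF ?radius_gt0// radiusE expRK cexpX -cexpD; congr cexp.
rewrite mulrCA -mulrDr; congr (_ * _).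
by rewrite -(rmorph_nat (real_complex R)) -rmorphM -rmorphD; congr (_%:C); ring.
Qed.

(** Here [la] is [2 (s - 1)], [w] is [q ^ (- la)], and the prefactor [q ^ (C la)] accounts for the
    shift in [radius]. *)
Definition zeta_value (la : R[i]) : R[i] := power_series_value
  (primitive_shell q volume) (C + K).+2 q (cexp (la * (C%:R * lq)%:C)) (la * (- lq)%:C).

(** Origin of the half-plane: [|w| = q ^ (- Re la)] is below [q] when [Re la > -1], that is, when
    [Re s > 1/2]. *)
Lemma convergence_ratio (la : R[i]) : -1 < complex.Re la ->
  expR (complex.Re (la * (- lq)%:C)) < q.
Proof.
case: la => a b /= a1; have q0 : 0 < q by rewrite (lt_trans _ q1).
have lq0 : 0 < lq by rewrite ln_gt0// q1.
rewrite mulr0 subr0 -[ltRHS]lnK ?posrE// ltr_expR -/lq mulrN -mulNr.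
by rewrite gtr_pMl//; lra.
Qed.

Section Part.
(* [P] stands for the real part or the imaginary part. *)
Variable P : R[i] -> R.
Hypothesis P_add : {morph P : x y / x + y}.
Hypothesis P_scale : forall (a : R) x, P (a%:C * x) = a * P x.
Hypothesis P_le : forall x, `|P x|%:C <= `|x|.
Variable la : R[i].
Hypothesis la_gt : -1 < complex.Re la.

Let f (v : borel F * borel F * borel F * borel F) : R := P (cpow (labs (quat p v : F)) la).
Let m (j : nat) : R := if j is j'.+1 then primitive_shell q volume j'
  else fine (haar4 mu (piece 0)).
Let c (j : nat) : R := if j is j'.+1 then P (cpow (radius j') la) else 0.

Let muE j : haar4 mu (piece j) = (m j)%:E.
Proof.
case: j => [|j]; last exact: measure_level.
rewrite /m fineK// ge0_fin_numE//.
apply: (@le_lt_trans _ _ (haar4 mu (quat_ball p 0))); last first.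
  by rewrite (quat_volumeE hmu mp) ltry.
apply: le_measure; rewrite ?inE; first exact: measurable_piece.
  exact: measurable_quat_ball.
move=> v [vV /= v0]; split; last by rewrite /= v0.
by move: vV; rewrite primitive_vectorsE => -[].
Qed.

Let fE j v : piece j v -> f v = c j.
Proof.
rewrite /f /c; case: j => [|j] [_ /= ->] //.
rewrite /cpow eqxx; have := P_scale 0 0; by rewrite mulr0 mul0r.
Qed.

Let sum_split (g : R -> R) n : g 0 = 0 ->
  \sum_(j < n.+1) m j * g (c j) =
  \sum_(j < n) primitive_shell q volume j * g (P (cpow (radius j) la)).
Proof. by move=> g0; rewrite big_ord_recl /= g0 mulr0 add0r. Qed.

Let geo := primitive_shell_geometric q1 volume_rec.
Let q0 : 0 < q. Proof. by rewrite (lt_trans _ q1). Qed.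

Let bounded : exists B, forall n, \sum_(j < n) m j * `|c j| <= B.
Proof.
have [B BP] := power_series_bound primitive_shell_ge0 q0 geo (convergence_ratio la_gt)
  (c := fun j => P (cpow (radius j) la)) (k0 := cexp (la * (C%:R * lq)%:C))
  (fun j => eq_ind _ (fun z => `|P (cpow (radius j) la)|%:C <= `|z|) (P_le _) _
    (cpow_radius la j)).
exists B => -[|n]; first by have := BP 0%N; rewrite !big_ord0.
by rewrite (sum_split (g := Num.norm)) ?normr0.
Qed.

Lemma integrable_part : (haar4 mu).-integrable V (EFin \o f).
Proof.
have [B BP] := bounded; rewrite primitive_vectors_pieces.
exact: (integrable_pieces measurable_piece trivIset_piece muE fE BP).
Qed.

Lemma Rintegral_part : Rintegral (haar4 mu) V f = P (zeta_value la).
Proof.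
have [B BP] := bounded; rewrite primitive_vectors_pieces.
apply: (Rintegral_pieces measurable_piece trivIset_piece muE fE BP).
rewrite -cvg_shiftS.
have := power_series_cvg (k0 := cexp (la * (C%:R * lq)%:C)) q0 geo
  (convergence_ratio la_gt) P_add P_scale P_le.
apply: cvg_trans; apply: near_eq_cvg; apply: nearW => n /=.
rewrite (sum_split (g := id))//.
by apply: eq_bigr => j _; rewrite cpow_radius.
Qed.

End Part.
End LevelIntegral.

(** * The continuation in [s] and its value at [s = 0] *)

Section Continuation.
Context (R : realType).
Local Notation C := (R[i])^o.

Lemma derivable_sum_ord (h : nat -> C -> C) (n : nat) (z : C) :
  (forall j, derivable (h j) z 1) -> derivable (fun s => \sum_(j < n) h j s) z 1.
Proof.
move=> dh; elim: n => [|n IH].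
  rewrite (_ : (fun s => _) = cst 0); first exact: derivable_cst.
  by apply/funext => s; rewrite big_ord0.
have := derivableD IH (dh n); congr (derivable _ z 1).
by apply/funext => s; rewrite big_ord_recr.
Qed.

Lemma cexp_twice_sub1 (x lq : R) (s : C) :
  cexp (2 * (s - 1) * (x * lq)%:C) =
  cexp (- (2 * (x * lq))%:C) * cexp ((2 * (x * lq))%:C * s).
Proof.
rewrite -cexpD; congr cexp; rewrite !rmorphM /= rmorph_nat; ring.
Qed.

End Continuation.

Theorem mainTheorem4 (R : realType) (F : nonarchLocalFieldType R)
    (hF : odd_residual_char F)
    (mu : {sigma_finite_measure set (borel F) -> \bar R})
    (hmu : normalized_haar mu)
    (A : F) (hA0 : A != 0) (hA : ~ exists a : F, A = a ^+ 2)
    (E : fieldExtType F) (rootA : E) (hrootA : rootA ^+ 2 = A%:A)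
    (hE : <<1; rootA>>%VS = {:E}%VS)
    (sigma : 'AEnd(E)) (hsigma : sigma != \1%AF)
    (D : E) (hD0 : D != 0)
    (hD : ~ exists (c : F) (e : E), [/\ c != 0, e != 0 & D = c *: e ^+ 2]) :
  (forall s : R[i], 2^-1 < complex.Re s ->
     zeta_converges mu A rootA sigma D s) /\
  continued_value [set s : (R[i])^o | 2^-1 < complex.Re s]
    (zeta mu A rootA sigma D) 0 0.
Proof.
have two1 := labs_two hF.
have two0 : (2 : F) != 0 by rewrite -(@labs_gt0 R) two1.
have [a [b [Dab QE]]] := quad_form_binary D two0 hA0 hrootA hE hsigma.
pose p := binary A b (2 * a).
have aniso := binary_anisotropic hA hrootA Dab hD0 hD.
have [C p_le] := @binary_bound R F A b (2 * a).
have [K p_gt] := @binary_lower_bound R F A b (2 * a) aniso.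
have mp := @measurable_fun_binary R F A b (2 * a).
have p_hom := @binary_hom R F A b (2 * a).
have integrandE s : (fun v : borel F * borel F * borel F * borel F =>
    let: (x, y, z, t) := v in zeta_integrand A rootA sigma D s x y z t) =
    (fun v => cpow (labs (quat p v : F)) (2 * (s - 1))).
  by apply/funext => -[[[x y] z] t]; rewrite /zeta_integrand QE.
have ReD : {morph @complex.Re R : x y / x + y} by move=> [? ?] [? ?].
have ImD : {morph @complex.Im R : x y / x + y} by move=> [? ?] [? ?].
have ReZ (k : R) x : complex.Re (k%:C * x) = k * complex.Re x.
  by case: x => ? ?; rewrite /= mul0r subr0.
have ImZ (k : R) x : complex.Im (k%:C * x) = k * complex.Im x.
  by case: x => ? ?; rewrite /= mul0r addr0.
have la_gt (s : R[i]) : 2^-1 < complex.Re s -> -1 < complex.Re (2 * (s - 1)).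
  rewrite -(rmorph_nat (real_complex R)) ReZ; case: s => x y /= hx; lra.
have ReI := integrable_part hmu mp two1 p_hom p_le p_gt ReZ (@normc_ge_Re R).
have ImI := integrable_part hmu mp two1 p_hom p_le p_gt ImZ (@normc_ge_Im R).
have Rei := Rintegral_part hmu mp two1 p_hom p_le p_gt ReD ReZ (@normc_ge_Re R).
have Imi := Rintegral_part hmu mp two1 p_hom p_le p_gt ImD ImZ (@normc_ge_Im R).
split=> [s /la_gt hs|].
  rewrite /zeta_converges /V0_integrable integrandE.
  by split; [exact: ReI|exact: ImI].
pose q : R := (@residue_card R F)%:R; have q1 : 1 < q := residue_card_real_gt1 F.
have q0 : 0 < q by rewrite (lt_trans _ q1).
pose lq := ln q; have lq0 : 0 < lq by rewrite ln_gt0.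
pose J := (C + K).+2; pose m := primitive_shell q (volume mu p C).
(* [term j s] is [|Q| ^ (2 (s - 1))] on level [j], split as a constant times [cexp] of a multiple of
   [s] so that it is visibly entire. *)
pose t (j : nat) : R := 2 * ((C%:R - j%:R) * lq).
pose term (j : nat) (s : (R[i])^o) : (R[i])^o := cexp (- (t j)%:C) * cexp ((t j)%:C * s).
pose pref : R[i] := ((1 - q^-1)^-1)%:C.
pose f1 (s : (R[i])^o) : (R[i])^o := pref * \sum_(j < J) (m j)%:C * term j s.
pose f2 (s : (R[i])^o) : (R[i])^o := pref * ((m J)%:C * term J s).
have dterm j (z : (R[i])^o) : derivable (term j) z 1.
  by apply: derivableM; [exact: derivable_cst|exact: derivable_cexp].
have df1 (z : (R[i])^o) : derivable f1 z 1.
  apply: derivableM; first exact: derivable_cst.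
  apply: (derivable_sum_ord (h := fun j s => (m j)%:C * term j s)) => j.
  by apply: derivableM; [exact: derivable_cst|exact: dterm].
have df2 (z : (R[i])^o) : derivable f2 z 1.
  apply: derivableM; first exact: derivable_cst.
  by apply: derivableM; [exact: derivable_cst|exact: dterm].
pose al : (R[i])^o := (- (2 * lq))%:C; pose be : (R[i])^o := q%:C.
have al0 : al != 0.
  by rewrite /al -[0]/(0%:C) (inj_eq (@complexI R)) oppr_eq0 mulf_neq0 ?gt_eqF.
have qE : expR lq = q by rewrite lnK// posrE.
(* Nonzero as [q > 1], so [s = 0] is not a pole. *)
have factor0 : pole_factor al be 0 = (1 - q)%:C.
  by rewrite /pole_factor mulr0 cexp0 mulr1 rmorphB.
have q10 : 1 - q != 0 by rewrite subr_eq0 lt_eqF.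
exists (pole_fun f1 f2 al be); split.
- by move=> z; exact: (@meromorphic_pole_fun R f1 f2 al be df1 df2 al0 z).
- move=> s /= /la_gt hs; rewrite /zeta /V0_integral integrandE /cintegral.
  rewrite Rei// Imi//; set Z := zeta_value _ _ _ _ _.
  have -> : complex.Re Z +i* complex.Im Z = Z by case: (Z).
  pose ka := cexp (2 * (s - 1) * (C%:R * lq)%:C).
  pose w := cexp (2 * (s - 1) * (- lq)%:C).
  have termE j : term j s = ka * w ^+ j.
    rewrite /term /t -cexp_twice_sub1 /ka /w cexpX -cexpD; congr cexp.
    by rewrite -(rmorph_nat (real_complex R)) !rmorphM !rmorphB !rmorphN /= !rmorph_nat; ring.
  have factorE : pole_factor al be s = 1 - w / q%:C.
    rewrite /pole_factor /be /w; congr (1 - _); apply: (mulIf (x := q%:C)).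
      by rewrite -[0]/(0%:C) (inj_eq (@complexI R)) gt_eqF.
    rewrite divfK; last by rewrite -[0]/(0%:C) (inj_eq (@complexI R)) gt_eqF.
    rewrite -qE -cexp_real mulrAC -!cexpD; congr cexp.
    by rewrite /al rmorphN !rmorphM /= !rmorph_nat; ring.
  have sumE : \sum_(j < J) (m j)%:C * term j s = ka * \sum_(j < J) (m j)%:C * w ^+ j.
    by rewrite mulr_sumr; apply: eq_bigr => j _; rewrite termE mulrCA.
  have ZE : Z = ka * (\sum_(j < J) (m j)%:C * w ^+ j
    + (m J)%:C * w ^+ J * (1 - w / q%:C)^-1) by [].
  rewrite /pole_fun /f1 /f2 sumE termE factorE ZE -/pref.
  move: (\sum_(j < J) _) ((1 - w / q%:C)^-1) (w ^+ J) => u1 u2 u3.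
  move: ((m J)%:C : R[i]) (pref : R[i]) (ka : R[i]) => u4 u5 u6.
  ring.
- by apply: (@holomorphic_pole_fun R f1 f2 al be df1 df2 0); rewrite factor0 -[0]/(0%:C) (inj_eq (@complexI R)).
- have term0 j : term j 0 = ((q ^+ 2) ^- C * (q ^+ 2) ^+ j)%:C.
    rewrite /term mulr0 cexp0 mulr1 -rmorphN cexp_real; congr (_%:C).
    have -> : - t j = j%:R * (2%:R * lq) + - (C%:R * (2%:R * lq)) by rewrite /t; ring.
    by rewrite expRD expRN !expRM_natl qE mulrC.
  have sum0 : \sum_(j < J) (m j)%:C * term j 0 =
      ((q ^+ 2) ^- C * \sum_(j < J) m j * (q ^+ 2) ^+ j)%:C.
    rewrite rmorphM rmorph_sum mulr_sumr; apply: eq_bigr => j _.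
    by rewrite term0 !rmorphM mulrCA.
  (* At [s = 0] each [term j] is [q ^ (2 j - 2 C)], so the value is [q ^ (- 2 C)] times the
     vanishing combination of [primitive_shell_sum]. *)
  have key : (q ^+ 2) ^- C * (\sum_(j < J) m j * (q ^+ 2) ^+ j) +
      m J * ((q ^+ 2) ^- C * (q ^+ 2) ^+ J) * (1 - q)^-1 = 0.
    have := primitive_shell_sum q1 (volume_rec hmu mp two1 p_hom p_gt (C := C)).
    rewrite -/q -/m -/J; move: (\sum_(j < J) _) ((1 - q)^-1) => S d /(congr1 ( *%R ((q ^+ 2) ^- C))).
    by rewrite mulr0 => <-; ring.
  rewrite /pole_fun factor0 /f1 /f2 sum0 term0 -[pref * _ * _]mulrA -mulrDr.
  by rewrite -fmorphV -!rmorphM -rmorphD key rmorph0 mulr0.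
Qed.
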